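(* Let $S=\{c_1,c_2,\dots,c_k\}$ be a finite nonempty multiset of positive integers ($k\ge 1$). Then there is a snark $G$ with a Hist $T$ such that $oc(G,T)=S$ if and only if (i) $c_j\geq 5$ for all $j=1,\dots,k$, and (ii) if $k=1$, then $c_1=6$ or $c_1\geq 10$.
   Context: A snark is a cyclically $4$-edge-connected cubic (3-regular) graph of girth at least $5$ that admits no proper $3$-edge-colouring. A Hist of a cubic graph $G$ is a spanning tree $T$ of $G$ with no vertex of degree two (so every vertex of $T$ has degree $1$ or $3$). Given a Hist $T$ of a cubic graph $G$, the edges of $G$ not in $T$ form vertex-disjoint cycles whose vertices are exactly the leaves of $T$; these are the outer cycles of $(G,T)$. If $C_1,\dots,C_k$ are all outer cycles, $oc(G,T)$ denotes the multiset $\{|V(C_1)|,\dots,|V(C_k)|\}$ of their lengths. *)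

(* Defs.v *)
From mathcomp Require Import all_boot.
Set Implicit Arguments. Unset Strict Implicit. Unset Printing Implicit Defensive.

Definition simple_graph (V : finType) (e : rel V) : Prop :=
  (forall x y, e x y = e y x) /\ (forall x, ~~ e x x).

Definition deg (V : finType) (e : rel V) (x : V) : nat := #|[set y | e x y]|.

Definition cubic (V : finType) (e : rel V) : Prop := forall x, deg e x = 3.

Definition is_cycle (V : finType) (e : rel V) (p : seq V) : Prop :=
  ucycle e p /\ 3 <= size p.

Definition girth_ge5 (V : finType) (e : rel V) : Prop :=
  forall p : seq V, is_cycle e p -> 5 <= size p.

Definition cut_size (V : finType) (e : rel V) (X : {set V}) : nat :=
  #|[set u : V * V | (u.1 \in X) && (u.2 \notin X) && e u.1 u.2]|.

Definition cyclically_4_edge_connected (V : finType) (e : rel V) : Prop :=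
  forall X : {set V},
    (exists p, is_cycle e p /\ all (fun v => v \in X) p) ->
    (exists q, is_cycle e q /\ all (fun v => v \notin X) q) ->
    4 <= cut_size e X.

Definition three_edge_colourable (V : finType) (e : rel V) : Prop :=
  exists c : V -> V -> 'I_3,
    (forall x y, c x y = c y x) /\
    (forall x y z, e x y -> e x z -> y != z -> c x y != c x z).

Definition snark (V : finType) (e : rel V) : Prop :=
  [/\ simple_graph e, cubic e, cyclically_4_edge_connected e, girth_ge5 e
    & ~ three_edge_colourable e].

Definition spanning_tree (V : finType) (e T : rel V) : Prop :=
  [/\ forall x y, T x y = T y x,
      forall x y, T x y -> e x y,
      forall x y, connect T x y
    & forall p, ~ is_cycle T p].

(* Hist: spanning tree without vertices of degree 2 (all degrees 1 or 3) *)
Definition hist (V : finType) (e T : rel V) : Prop :=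
  spanning_tree e T /\ forall x, (deg T x == 1) || (deg T x == 3).

Definition leaves (V : finType) (T : rel V) : {set V} := [set x | deg T x == 1].

Definition cotree (V : finType) (e T : rel V) : rel V :=
  fun x y => e x y && ~~ T x y.

Definition outer_cycles (V : finType) (e T : rel V) : {set {set V}} :=
  [set [set y | connect (cotree e T) x y] | x in leaves T].

Definition oc (V : finType) (e T : rel V) : seq nat :=
  map (fun C : {set V} => #|C|) (enum (outer_cycles e T)).

(* Main.v *)
Require Import Defs.
From mathcomp Require Import all_boot.
From mathcomp Require Import zify.
Set Implicit Arguments. Unset Strict Implicit. Unset Printing Implicit Defensive.

(* Sufficiency. Two disjoint edges ab, cd of a snark G are replaced by a 4-pole
   obtained from Petersen graphs, in every 3-edge-colouring of which the ends at a
   and b have equal colours, and so have those at c and d; the result is again a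
   snark. If cd lies in the hist, suitable 4-poles either lengthen a given outer
   cycle by 4, lengthen it by 2 and add a new one of length 7, or only add a new one
   of length 5, 6 or 8. Lengthening by 4 reduces all lengths to 5..8; with three or
   more cycles one can then remove a 5, 6 or 8, or, if all lengths are 7, go back to
   5, 7, ..., 7 with one cycle less. The cases with one or two cycles come from
   finitely many explicit snarks.
   Necessity. Outer cycles have length at least 5 by the girth condition. For a
   single outer cycle of length 5, 7, 8 or 9, the graph is given by a binary tree
   with leaves labelled by the positions on the cycle; all such trees that create no
   cycle of length 3 or 4 are enumerated, and each of these graphs is
   3-edge-colourable. *)

(** * Rooted hists *)

(** Uncolourability is inherited because ab and cd can be given the common colours of their ends.
    For the Petersen graph minus adjacent vertices u, v this equality is a parity effect: each
    colour occurs an even number of times on the four ends, so different colours on the two ends at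
    u would recur at v, and the Petersen graph would be colourable. A tree with all degrees 1 or 3
    has two more leaves than internal vertices. Hence a 4-pole on 2k vertices raises the total
    length of the outer cycles by k, and a snark with total length s has 2s - 2 vertices; this fixes
    the sizes of all gadgets and explicit graphs. The obstacle in the sufficiency part is that 5, 7,
    8 and 9 do not occur alone, so an induction cannot descend to one short cycle; this is why pairs
    are the base case and why several of them need explicit graphs. In the necessity part, colours
    of the outer cycle determine those of the tree edges at the leaves and then, from the leaves
    upwards, of the whole tree. Only one comparison remains, at the leaf taken as root. *)

Definition no_short_cycle (V : finType) (e : rel V) : Prop :=
  [/\ irreflexive e,
      forall x y z, e x y -> e y z -> e z x -> False &
      forall x y z w, e x y -> e y z -> e z w -> e w x ->
        x != z -> y != w -> False].

Lemma girth_ge5_no_short (V : finType) (e : rel V) :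
  no_short_cycle e -> girth_ge5 e.
Proof.
move=> [irr tri sq] p [/andP[cyc up] p3].
case: p cyc up p3 => [|x [|y [|z [|w [|v p]]]]] //=.
- by rewrite andbT => /and3P[xy yz zx] _ _; case: (tri x y z).
- rewrite andbT => /and4P[xy yz zw wx]; rewrite !inE !negb_or.
  case/and3P=> /and3P[_ xz _] /andP[_ yw] _ _.
  by case: (sq x y z w).
Qed.

Lemma no_short_girth_ge5 (V : finType) (e : rel V) :
  simple_graph e -> girth_ge5 e -> no_short_cycle e.
Proof.
move=> [sym irr] g5.
have neq x y : e x y -> x != y by move=> xy; apply: contraTneq xy => ->.
split=> [x|x y z xy yz zx|x y z w xy yz zw wx xz yw]; first exact/negbTE.
- suff /g5 : is_cycle e [:: x; y; z] by [].
  split=> //; apply/andP; split; first by rewrite /= xy yz zx.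
  by rewrite /= !inE negb_or (neq _ _ xy) (neq _ _ yz) eq_sym (neq _ _ zx).
- suff /g5 : is_cycle e [:: x; y; z; w] by [].
  split=> //; apply/andP; split; first by rewrite /= xy yz zw wx.
  rewrite /= !inE !negb_or (neq _ _ xy) (neq _ _ yz) (neq _ _ zw) xz yw.
  by rewrite eq_sym (neq _ _ wx).
Qed.

(* In a cubic graph a vertex set that is a forest and has at most three leaving
   edges is a singleton, so sizes can replace cycles in the definition of
   cyclic 4-edge-connectivity. *)
Definition ess4_connected (V : finType) (e : rel V) : Prop :=
  forall X : {set V}, 2 <= #|X| -> 2 <= #|~: X| -> 4 <= cut_size e X.

Lemma ess4_cyclically4 (V : finType) (e : rel V) :
  ess4_connected e -> cyclically_4_edge_connected e.
Proof.
have card_cycle (X : {set V}) p : is_cycle e p -> {subset p <= X} -> 2 <= #|X|.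
  move=> [/andP[_ up] p3] pX; rewrite (leq_trans (ltnW p3)) //.
  by rewrite -(card_uniqP up) subset_leq_card //; apply/subsetP.
move=> ess X [p [cp /allP pX]] [q [cq /allP qX]]; apply: ess.
  exact: card_cycle cp pX.
by apply: (card_cycle _ q) => // x /qX; rewrite inE.
Qed.

Record essential_snark (V : finType) (e : rel V) : Prop := EssentialSnark {
  es_sym : symmetric e;
  es_cubic : cubic e;
  es_short : no_short_cycle e;
  es_ess4 : ess4_connected e;
  es_col : ~ three_edge_colourable e
}.

Lemma essential_snark_snark (V : finType) (e : rel V) :
  essential_snark e -> snark e.
Proof.
case=> sym cub short ess col; split=> //.
- by split=> // x; case: short => ->.
- exact: ess4_cyclically4.
- exact: girth_ge5_no_short.
Qed.

Definition parent_rel (V : eqType) (par : V -> V) (rk : V -> nat) : rel V :=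
  fun x y => (0 < rk x) && (par x == y) || (0 < rk y) && (par y == x).

(** Connectedness and acyclicity become the local condition [rh_par]: parents lower the rank until
    the only vertex of rank 0 is reached. Inserting a gadget then amounts to giving a new parent map
    and a new rank. *)
Record rooted_hist (V : finType) (e : rel V) (par : V -> V) (rk : V -> nat)
    (cs : seq (seq V)) : Prop := RootedHist {
  rh_root : forall x y, rk x = 0 -> rk y = 0 -> x = y;
  rh_par : forall x, 0 < rk x -> e x (par x) /\ rk (par x) < rk x;
  rh_deg : forall x,
    deg (parent_rel par rk) x = if x \in flatten cs then 1 else 3;
  rh_uniq : uniq (flatten cs);
  rh_cycle : forall c, c \in cs ->
    cycle (cotree e (parent_rel par rk)) c /\ 2 < size c
}.

Lemma parent_relC (V : eqType) (par : V -> V) (rk : V -> nat) :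
  symmetric (parent_rel par rk).
Proof. by move=> x y; rewrite /parent_rel orbC. Qed.

Lemma next_neq_prev (V : eqType) (p : seq V) x :
  uniq p -> 2 < size p -> x \in p -> next p x != prev p x.
Proof.
move=> up p3 xp; apply/eqP => E.
have {E} : next p (next p x) = x by rewrite E next_prev.
case: (rot_to xp) => i q E; rewrite -!(next_rot i up) E.
have : uniq (x :: q) by rewrite -E rot_uniq.
have : 2 < size (x :: q) by rewrite -E size_rot.
case: q {E} => [|y [|z q]] //= _ /andP[]; rewrite !inE !negb_or.
case/and3P=> /negbTE xy xz _ _.
by rewrite eqxx eq_sym xy eqxx => E; rewrite E eqxx in xz.
Qed.

(** The successor and predecessor of [y] are already two distinct neighbours, and [y] has no third
    one. *)
Lemma cycle_closed_nbr (V : finType) (C : rel V) (q : seq V) y z :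
  symmetric C -> cycle C q -> uniq q -> 2 < size q -> y \in q -> deg C y = 2 ->
  C y z -> (z == next q y) || (z == prev q y).
Proof.
move=> symC cyc uq q3 yq dy Cyz; apply: contraT; rewrite negb_or => /andP[zn zp].
have : [set next q y; prev q y; z] \subset [set w | C y w].
  apply/subsetP => w; rewrite !inE => /orP[/orP[]|] /eqP-> //.
    exact: next_cycle.
  by rewrite symC prev_cycle.
move/subset_leq_card; rewrite -/(deg C y) dy.
by rewrite -setUA !cardsU1 cards1 !inE !negb_or next_neq_prev // eq_sym zn eq_sym zp.
Qed.

Section RootedHist.
Variables (V : finType) (e : rel V) (par : V -> V) (rk : V -> nat).
Variable cs : seq (seq V).
Hypothesis symE : symmetric e.
Hypothesis cubE : cubic e.
Hypothesis rh : rooted_hist e par rk cs.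
Notation T := (parent_rel par rk).
Notation C := (cotree e T).

Lemma parent_rel_sub : subrel T e.
Proof.
move=> x y /orP[] /andP[r0 /eqP<-]; first by case: (rh_par rh r0).
by rewrite symE; case: (rh_par rh r0).
Qed.

Lemma parent_rel_up x y : T x y -> rk y <= rk x -> par x = y.
Proof.
case/orP=> /andP[r0 /eqP//] E; case: (rh_par rh r0) => _; rewrite E; lia.
Qed.

Lemma parent_rel_connect x y : connect T x y.
Proof.
have symT := sym_connect_sym (parent_relC par rk).
have up : forall n x, rk x <= n -> exists2 r, rk r = 0 & connect T x r.
  elim=> [|n IHn] z zn; first by exists z => //; lia.
  case: (posnP (rk z)) => [z0|z0]; first by exists z.
  case: (rh_par rh z0) => _ lt; case: (IHn (par z)) => [|r r0 cr]; first lia.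
  exists r => //; apply: connect_trans cr; apply: connect1.
  by rewrite /parent_rel z0 eqxx.
case: (up _ x (leqnn _)) => r r0 xr; case: (up _ y (leqnn _)) => s s0 ys.
apply: connect_trans xr _; rewrite symT.
by rewrite (rh_root rh r0 s0).
Qed.

(* The vertex of largest rank on a cycle would have to be a child of both its
   neighbours. *)
Lemma parent_rel_acyclic p : ~ is_cycle T p.
Proof.
case=> /andP[cyc up] p3.
have [x xp maxx] : exists2 x, x \in p & {in p, forall y, rk y <= rk x}.
  case: p p3 {cyc up} => // x0 p _.
  case: (arg_maxnP (P := [in x0 :: p]) rk (mem_head x0 p)) => x xp mx.
  by exists x => // y /mx.
have nx := next_cycle cyc xp; have px := prev_cycle cyc xp.
have E1 := parent_rel_up nx (maxx _ (etrans (mem_next p x) xp)).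
rewrite parent_relC in px.
have E2 := parent_rel_up px (maxx _ (etrans (mem_prev p x) xp)).
by have := next_neq_prev up p3 xp; rewrite -E1 -E2 eqxx.
Qed.

Lemma rooted_hist_hist : hist e T.
Proof.
split; last by move=> x; rewrite (rh_deg rh); case: ifP.
split=> [x y|x y|x y|p]; first exact: parent_relC.
- exact: parent_rel_sub.
- exact: parent_rel_connect.
- exact: parent_rel_acyclic.
Qed.

Lemma deg_cotree x : x \in flatten cs -> deg C x = 2.
Proof.
move=> xcs; rewrite /deg.
have -> : [set y | C x y] = [set y | e x y] :\: [set y | T x y].
  by apply/setP => y; rewrite !inE andbC.
rewrite cardsD (setIidPr _).
  by move: (cubE x) (rh_deg rh x); rewrite xcs /deg => -> ->.
by apply/subsetP => y; rewrite !inE => /parent_rel_sub.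
Qed.

Lemma cotree_sym : symmetric C.
Proof. by move=> x y; rewrite /cotree symE parent_relC. Qed.

(** A leaf has cotree degree 2 and finds both cotree neighbours on its own list, so no cotree walk
    leaves [c]. *)
Lemma outer_cycle_component c x :
  c \in cs -> x \in c -> [set y | connect C x y] = [set y in c].
Proof.
move=> cin xc; case: (rh_cycle rh cin) => cyc c3.
have uc : uniq c.
  by move: (rh_uniq rh); case/splitPr: cin => s1 s2; rewrite flatten_cat cat_uniq /=
    cat_uniq => /and3P[_ _ /and3P[]].
have nbr y z : y \in c -> C y z -> z \in c.
  move=> yc Cyz; have dy : deg C y = 2.
    by apply: deg_cotree; apply/flattenP; exists c.
  by case/orP: (cycle_closed_nbr cotree_sym cyc uc c3 yc dy Cyz) => /eqP->;
    rewrite ?mem_next ?mem_prev.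
apply/setP => y; rewrite !inE; apply/idP/idP => [/connectP[p]|].
  elim: p x xc => [|z p IHp] x xc /=; first by move=> _ ->.
  by case/andP=> /(nbr _ _ xc) zc; apply: IHp.
exact: (connect_cycle cyc).
Qed.

Lemma oc_rooted_hist : perm_eq (oc e T) (map size cs).
Proof.
pose f (c : seq V) : {set V} := [set y in c].
(* The lists are nonempty and disjoint, so different lists have different vertex sets. Otherwise
   multiplicities would be lost in the set of outer cycles. *)
have cs_uniq : uniq cs /\ {in cs &, injective f} /\ {in cs, forall c, uniq c}.
  have ne : forall c, c \in cs -> exists x, x \in c.
    move=> c /(rh_cycle rh)[_]; case: c => // x c _; exists x; exact: mem_head.
  move: (rh_uniq rh) ne; elim: cs => //= c l IHl.
  rewrite cat_uniq => /and3P[uc dis ul] ne.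
  case: IHl => // [d dl|]; first by apply: ne; rewrite inE dl orbT.
  move=> ul' [inj un].
  have H d x : d \in l -> x \in c -> x \in d -> False.
    by move=> dl yc yd; case/hasP: dis; exists x => //; apply/flattenP; exists d.
  split; last split.
  - apply/andP; split=> //; apply/negP => cl.
    by case: (ne c (mem_head _ _)) => x xc; exact: (H _ _ cl xc xc).
  - move=> d d'; rewrite !inE => /orP[/eqP->|dl] /orP[/eqP->|dl'] //.
    + move/setP=> E; case: (ne c (mem_head _ _)) => x xc.
      by move: (E x); rewrite !inE xc => /esym/(H _ _ dl' xc).
    + move/setP=> E; case: (ne c (mem_head _ _)) => x xc.
      by move: (E x); rewrite !inE xc => /(H _ _ dl xc).
    + exact: inj.
  - by move=> d; rewrite inE => /orP[/eqP->|/un].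
case: cs_uniq => ucs [inj un].
have -> : map size cs = map (fun X : {set V} => #|X|) (map f cs).
  rewrite -map_comp; apply/eq_in_map => c ccs /=.
  by rewrite /f cardsE; apply/esym/card_uniqP; exact: un.
apply: perm_map; apply: uniq_perm; first exact: enum_uniq.
  by rewrite map_inj_in_uniq.
move=> X; rewrite mem_enum; apply/imsetP/mapP.
  case=> x; rewrite inE (rh_deg rh); case: ifP => // /flattenP[c ccs xc] _ ->.
  by exists c => //; exact: outer_cycle_component.
case=> c ccs ->; case: (rh_cycle rh ccs) => _ c3.
have [x xc] : exists x, x \in c by case: c c3 {ccs} => // x c _; exists x; rewrite mem_head.
exists x; last by rewrite (outer_cycle_component ccs xc).
rewrite inE (rh_deg rh); suff -> : x \in flatten cs by [].
by apply/flattenP; exists c.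
Qed.

End RootedHist.

(** Eight vertices leave room to choose the tree edge cd away from ab: at most seven choices of d
    are ever excluded. *)
Definition realizable (S : seq nat) : Prop :=
  exists (V : finType) (e : rel V) (par : V -> V) (rk : V -> nat) (cs : seq (seq V)),
    [/\ essential_snark e, rooted_hist e par rk cs,
        perm_eq (map size cs) S & 8 <= #|V|].

Lemma realizable_perm S1 S2 : perm_eq S1 S2 -> realizable S1 -> realizable S2.
Proof.
move=> S12 [V [e [par [rk [cs [es rh pcs V8]]]]]].
by exists V, e, par, rk, cs; split=> //; apply: perm_trans S12.
Qed.

Lemma realizable_snark_hist S : realizable S ->
  exists (V : finType) (e T : rel V), snark e /\ hist e T /\ perm_eq (oc e T) S.
Proof.
move=> [V [e [par [rk [cs [es rh pcs V8]]]]]].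
exists V, e, (parent_rel par rk); split; first exact: essential_snark_snark.
split; first exact: rooted_hist_hist (es_sym es) rh.
exact: perm_trans (oc_rooted_hist (es_sym es) (es_cubic es) rh) pcs.
Qed.

(** * Graphs given by adjacency lists *)

Notation adjacency := (seq (seq nat)).

Definition nbs (adj : adjacency) (i : nat) : seq nat := nth [::] adj i.

Definition adjacency_ok (n : nat) (adj : adjacency) : bool :=
  all (fun i => [&& uniq (nbs adj i), i \notin nbs adj i,
    all (fun j => (j < size adj) && (i \in nbs adj j)) (nbs adj i) &
    (i < n) ==> (size (nbs adj i) == 3)]) (iota 0 (size adj)).

(* Vertices numbered [n] and above are dangling ends: a short cycle through them
   is not a cycle of the graph. *)
Definition short_free (n : nat) (adj : adjacency) : bool :=
  let inner i := [seq j <- nbs adj i | j < n] in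
  all (fun i => all (fun j => all (fun k => (i == k) ||
     (i \notin nbs adj k) &&
     all (fun l => (l == j) || (i \notin nbs adj l)) (inner k))
    (inner j)) (inner i)) (iota 0 n).

(* Branch and bound over all two-colourings of the vertices whose cut has at most
   three edges; [bk] lists for each vertex its neighbours of smaller number. *)
Fixpoint cut_search (bk : adjacency) (s : seq bool) (k : nat)
    (P : seq bool -> nat -> bool) : bool :=
  if bk is l :: bk' then
    all (fun b => let k' := k + count (fun j => nth false s j != b) l in
      if k' <= 3 then cut_search bk' (rcons s b) k' P else true) [:: true; false]
  else P s k.

Definition earlier (adj : adjacency) : adjacency :=
  [seq [seq j <- nbs adj i | j < i] | i <- iota 0 (size adj)].

(** Backtracking over edge colourings; [bk] lists for each edge the earlier edges that share an end
    with it. Success with [xpred0] means that there is no proper colouring. *)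
Fixpoint colour_search (bk : adjacency) (s : seq nat) (P : seq nat -> bool) :
    bool :=
  if bk is l :: bk' then
    all (fun c => if has (fun j => nth 3 s j == c) l then true
                  else colour_search bk' (rcons s c) P) (iota 0 3)
  else P s.

Definition edges (adj : adjacency) : seq (nat * nat) :=
  flatten [seq [seq (i, j) | j <- nbs adj i & i < j] | i <- iota 0 (size adj)].

Definition adjacent_edges (x y : nat * nat) : bool :=
  [|| x.1 == y.1, x.1 == y.2, x.2 == y.1 | x.2 == y.2].

Definition conflicts (E : seq (nat * nat)) : adjacency :=
  [seq [seq j <- iota 0 i | adjacent_edges (nth (0, 0) E j) (nth (0, 0) E i)]
     | i <- iota 0 (size E)].

Definition cut_sum (adj : adjacency) (f : nat -> bool) : nat :=
  \sum_(i < size adj) \sum_(j < size adj) ((val j \in nbs adj i) && f i && ~~ f j).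

(** Ordered pairs are grouped by their larger index, which is how [cut_search] meets them when it
    adds one vertex at a time. *)
Lemma sum_triangle (F : nat -> nat -> nat) n :
  \sum_(i < n) \sum_(j < n) F i j =
  \sum_(i < n) (F i i + \sum_(j < i) (F i j + F j i)).
Proof.
elim: n => [|n IHn]; first by rewrite !big_ord0.
rewrite !big_ord_recr /= -IHn.
under eq_bigr do rewrite big_ord_recr /=.
rewrite !big_split /=; lia.
Qed.

Lemma sum_mem_count (p : pred nat) s n : uniq s ->
  \sum_(j < n) ((val j \in s) && p j : nat) = count p [seq j <- s | j < n].
Proof.
move=> us; rewrite -size_filter -filter_predI -(big_mkord xpredT (fun j => ((j \in s) && p j : nat))).
rewrite -big_mkcond /= -sum1_size big_filter.
rewrite -[LHS]big_filter -[RHS]big_filter.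
apply: perm_big; apply: uniq_perm; rewrite ?filter_uniq ?iota_uniq //.
move=> j; rewrite !mem_filter mem_index_iota /=.
by case: (p j); case: (j \in s) => //=; rewrite ?andbT ?andbF.
Qed.

Section Adjacency.
Variables (n : nat) (adj : adjacency).
Hypothesis adjP : adjacency_ok n adj.
Notation N := (size adj).

Lemma nbs_uniq i : uniq (nbs adj i).
Proof.
case: (ltnP i N) => iN; last by rewrite /nbs nth_default.
by have /allP/(_ i) := adjP; rewrite mem_iota iN => /(_ isT)/and4P[].
Qed.

Lemma nbs_ltn i j : j \in nbs adj i -> (i < N) && (j < N).
Proof.
case: (ltnP i N) => iN; last by rewrite /nbs nth_default.
have /allP/(_ i) := adjP; rewrite mem_iota iN => /(_ isT)/and4P[_ _ /allP H _].
by move=> /H /andP[].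
Qed.

Lemma nbsC i j : (j \in nbs adj i) = (i \in nbs adj j).
Proof.
have H : forall i j, j \in nbs adj i -> i \in nbs adj j.
  move=> {i j} i j jadj; have /andP[iN _] := nbs_ltn jadj.
  have /allP/(_ i) := adjP; rewrite mem_iota iN => /(_ isT)/and4P[_ _ /allP/(_ _ jadj)].
  by case/andP.
by apply/idP/idP; apply: H.
Qed.

Lemma nbs_irr i : (i \in nbs adj i) = false.
Proof.
apply/negP => iadj; have /andP[iN _] := nbs_ltn iadj.
have /allP/(_ i) := adjP; rewrite mem_iota iN => /(_ isT)/and4P[_].
by rewrite iadj.
Qed.

Lemma size_nbs i : i < n -> n <= N -> size (nbs adj i) = 3.
Proof.
move=> iltn nN; have /allP/(_ i) := adjP.
rewrite mem_iota (leq_trans iltn nN) => /(_ isT)/and4P[_ _ _].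
by rewrite iltn => /eqP.
Qed.

Lemma cut_sumE f : cut_sum adj f =
  \sum_(i < N) count (fun j => f j != f i) (nth [::] (earlier adj) i).
Proof.
rewrite /cut_sum (sum_triangle (fun i j => (j \in nbs adj i) && f i && ~~ f j)).
apply: eq_bigr => i _; rewrite nbs_irr add0n.
rewrite (nth_map 0) ?size_iota // nth_iota // add0n.
rewrite -(@sum_mem_count (fun j => f j != f i)) ?nbs_uniq //.
apply: eq_bigr => j _; rewrite (nbsC j).
by case: (_ \in _); case: (f i); case: (f j).
Qed.

Lemma cut_searchP (P : seq bool -> nat -> bool) f :
  cut_search (earlier adj) [::] 0 P -> cut_sum adj f <= 3 ->
  P (mkseq f N) (cut_sum adj f).
Proof.
rewrite cut_sumE; set bk := earlier adj.
have bkN : size bk = N by rewrite size_map size_iota.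
(* [K i] counts the cut edges among the first [i] vertices. It grows with [i], so a branch abandoned
   above 3 cannot lead to a cut of size at most 3. *)
pose K i := \sum_(j < i) count (fun k => f k != f j) (nth [::] bk j).
rewrite -/(K N).
have bk_lt i : all (fun j => j < i) (nth [::] bk i).
  case: (ltnP i N) => iN; last by rewrite nth_default ?bkN.
  rewrite (nth_map 0) ?size_iota // nth_iota // add0n.
  by apply/allP => j; rewrite mem_filter => /andP[].
have Kmono i : K i <= K i.+1 by rewrite /K big_ord_recr leq_addr.
(* The branch followed is that of [f] itself: [i] vertices are decided and [d] remain. *)
suff H d i : d + i = N -> cut_search (drop i bk) (mkseq f i) (K i) P -> K N <= 3 ->
    P (mkseq f N) (K N).
  by move=> cs; apply: (H N 0); rewrite ?addn0 // drop0 /K big_ord0.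
elim: d i => [|d IHd] i; first by rewrite add0n => ->; rewrite drop_oversize ?bkN.
move=> dN; rewrite (drop_nth [::]) ?bkN; last lia.
move=> /= /and3P[Ht Hf _] K3; apply: (IHd i.+1) => //; first lia.
have Ki : K i.+1 = K i + count (fun j => nth false (mkseq f i) j != f i) (nth [::] bk i).
  rewrite /K big_ord_recr /=; congr (_ + _); apply: eq_in_count => j jb.
  by rewrite nth_mkseq //; have /allP := bk_lt i; apply.
have K3' : K i.+1 <= 3.
  apply: leq_trans K3; have -> : N = i.+1 + d by lia.
  elim: (d) => [|m IHm]; first by rewrite addn0.
  by rewrite addnS (leq_trans IHm).
rewrite mkseqS.
by move: Ht Hf; case E: (f i); rewrite E in Ki; rewrite -Ki K3'.
Qed.

Definition colours_adjacency (f : nat -> nat -> nat) : Prop :=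
  [/\ forall i j, f i j < 3, forall i j, f i j = f j i &
      forall i j k, j \in nbs adj i -> k \in nbs adj i -> j != k ->
        f i j != f i k].

Lemma mem_edges x : x \in edges adj -> (x.2 \in nbs adj x.1) && (x.1 < x.2).
Proof.
case/flattenP=> l /mapP[i _ ->] /mapP[j].
by rewrite mem_filter => /andP[ij jadj] -> /=; rewrite jadj ij.
Qed.

Lemma edges_mem i j : j \in nbs adj i -> i < j -> (i, j) \in edges adj.
Proof.
move=> jadj ij; apply/flattenP; exists [seq (i, j) | j <- nbs adj i & i < j].
  by apply/mapP; exists i => //; rewrite mem_iota; case/andP: (nbs_ltn jadj).
by apply/mapP; exists j => //; rewrite mem_filter ij.
Qed.

Lemma edges_uniq : uniq (edges adj).
Proof.
rewrite /edges; elim: (iota _ _) (iota_uniq 0 N) => //= i s IHs /andP[i_s us].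
rewrite cat_uniq IHs // andbT; apply/andP; split.
  by rewrite map_inj_uniq ?filter_uniq ?nbs_uniq // => j k [].
apply/hasPn => x /flattenP[l /mapP[k ks ->] /mapP[j _ ->]].
apply/negP => /mapP[j' _ [ki _]]; by rewrite -ki ks in i_s.
Qed.

Lemma colour_searchP (P : seq nat -> bool) f :
  colour_search (conflicts (edges adj)) [::] P -> colours_adjacency f ->
  P [seq f x.1 x.2 | x <- edges adj].
Proof.
move=> cs [f3 fC fP]; move: cs; set E := edges adj; set bk := conflicts E.
have bkN : size bk = size E by rewrite size_map size_iota.
pose g i := f (nth (0, 0) E i).1 (nth (0, 0) E i).2.
have -> : [seq f x.1 x.2 | x <- E] = mkseq g (size E).
  by rewrite -[in LHS](mkseq_nth (0, 0) E) -map_comp.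
(* The four cases tell which ends of the two edges coincide; symmetry of [f] brings the common
   vertex to the front. *)
have bkP i j : i < size E -> j \in nth [::] bk i -> (j < i) && (g j != g i).
  move=> iE; rewrite (nth_map 0) ?size_iota // nth_iota // add0n mem_filter mem_iota.
  rewrite add0n => /andP[sh /= ji]; rewrite ji /= /g.
  have jE := ltn_trans ji iE.
  have := mem_edges (mem_nth (0, 0) jE); have := mem_edges (mem_nth (0, 0) iE).
  have := nth_uniq (0, 0) jE iE edges_uniq; rewrite (ltn_eqF ji) -/E.
  move: sh; case: (nth _ E j) => a b; case: (nth _ E i) => c d /=.
  rewrite xpair_eqE /adjacent_edges /= => sh ne /andP[cd ltcd] /andP[ab ltab].
  case/or4P: sh => /eqP E1.
  - by subst c; apply: fP => //; apply: contraFneq ne => ->; rewrite !eqxx.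
  - by subst d; rewrite (fC c); apply: fP => //; [rewrite nbsC | lia].
  - by subst c; rewrite (fC a); apply: fP => //; [rewrite nbsC | lia].
  - subst d; rewrite (fC a) (fC c); apply: fP; rewrite 1?nbsC //.
    by apply: contraFneq ne => ->; rewrite !eqxx.
suff H d i : d + i = size E -> colour_search (drop i bk) (mkseq g i) P ->
    P (mkseq g (size E)).
  by move=> cs; apply: (H (size E) 0); rewrite ?addn0 ?drop0.
elim: d i => [|d IHd] i; first by rewrite add0n => ->; rewrite drop_oversize ?bkN.
move=> dN; rewrite (drop_nth [::]) ?bkN; last lia.
move=> /allP /= /(_ (g i)); rewrite -[[:: 0; 1; 2]]/(iota 0 3) mem_iota f3 => /(_ isT).
case: ifP => [/hasP[j jb]|_]; last first.
  by rewrite -mkseqS; apply: IHd; lia.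
have /andP[ji gji] := bkP i j ltac:(lia) jb.
by rewrite nth_mkseq // (negbTE gji).
Qed.

Lemma short_freeP : short_free n adj ->
  (forall i j k, i < n -> j < n -> k < n ->
     j \in nbs adj i -> k \in nbs adj j -> i \in nbs adj k -> False) /\
  (forall i j k l, i < n -> j < n -> k < n -> l < n ->
     j \in nbs adj i -> k \in nbs adj j -> l \in nbs adj k -> i \in nbs adj l ->
     i != k -> j != l -> False).
Proof.
move=> /allP H.
have {}H i j k : i < n -> j < n -> k < n -> j \in nbs adj i -> k \in nbs adj j ->
    i != k -> (i \notin nbs adj k) &&
     all (fun l => (l == j) || (i \notin nbs adj l)) [seq l <- nbs adj k | l < n].
  move=> iN jN kN ij jk ik; have /allP := H i ltac:(by rewrite mem_iota).
  move=> /(_ j); rewrite mem_filter jN ij => /(_ isT)/allP/(_ k).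
  by rewrite mem_filter kN jk (negbTE ik) => /(_ isT).
split=> [i j k iN jN kN ij jk ki|i j k l iN jN kN lN ij jk kl li ik jl].
  have ik : i != k by apply: contraTneq ki => ->; rewrite nbs_irr.
  by have /andP[] := H i j k iN jN kN ij jk ik; rewrite ki.
have /andP[_ /allP/(_ l)] := H i j k iN jN kN ij jk ik.
by rewrite mem_filter lN kl li eq_sym (negbTE jl) => /(_ isT).
Qed.

End Adjacency.

(** * Explicit snarks *)

Lemma card_set_sum (T : finType) (P : pred T) : #|[set x | P x]| = \sum_x (P x : nat).
Proof. by rewrite -sum1_card big_mkcond; apply: eq_bigr => x _; rewrite inE; case: (P x). Qed.

Lemma cut_size_sum (V : finType) (e : rel V) (X : {set V}) :
  cut_size e X = \sum_x \sum_y (e x y && (x \in X) && (y \notin X)).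
Proof.
rewrite /cut_size card_set_sum pair_bigA; apply: eq_bigr => [[x y] _] /=.
by case: (e x y); case: (x \in X); case: (y \in X).
Qed.

Lemma cut_sizeC (V : finType) (e : rel V) (X : {set V}) :
  symmetric e -> cut_size e (~: X) = cut_size e X.
Proof.
move=> symE; rewrite !cut_size_sum exchange_big; apply: eq_bigr => x _.
by apply: eq_bigr => y _; rewrite symE !inE negbK andbAC.
Qed.

(* Vertices are numbered so that parents in the tree have smaller numbers; the
   number then serves as rank, and the root 0 is its own parent. *)
Record base := Base {
  base_adj : adjacency;
  base_par : seq nat;
  base_cycles : seq (seq nat)
}.

(** The test passed to [cut_search] is [ess4_connected] in contrapositive form: a cut of at most
    three edges leaves at most one vertex on some side. *)
Definition base_ok (B : base) : bool :=
  let adj := base_adj B in let n := size adj in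
  let par := nth 0 (base_par B) in
  let tree := parent_rel par id in
  let cs := base_cycles B in
  [&& (8 <= n) && adjacency_ok n adj, short_free n adj,
      cut_search (earlier adj) [::] 0
        (fun s _ => (count id s <= 1) || (n <= (count id s).+1)),
      colour_search (conflicts (edges adj)) [::] xpred0,
      all (fun i => (0 < i) ==> (par i \in nbs adj i) && (par i < i)) (iota 0 n),
      all (fun i => count (tree i) (nbs adj i) ==
                    if i \in flatten cs then 1 else 3) (iota 0 n),
      uniq (flatten cs) && all (fun i => i < n) (flatten cs) &
      all (fun c => cycle (fun i j => (j \in nbs adj i) && ~~ tree i j) c &&
                    (2 < size c)) cs].

Section BaseGraph.
Variable B : base.
Notation adj := (base_adj B).
Notation n := (size adj).
Notation par := (nth 0 (base_par B)).
Hypothesis BP : base_ok B.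

Let V := 'I_n.
Let e : rel V := fun x y => val y \in nbs adj x.

Let adjP : adjacency_ok n adj.
Proof. by case/and5P: BP => /andP[]. Qed.

Let n8 : 8 <= n.
Proof. by case/and5P: BP => /andP[]. Qed.

Let card_nbs (p : pred nat) (x : V) : #|[set y | e x y & p (val y)]| = count p (nbs adj x).
Proof.
rewrite card_set_sum (@sum_mem_count p) ?(nbs_uniq adjP) //.
congr count; apply/all_filterP/allP => j /(nbs_ltn adjP) /andP[] //.
Qed.

Let cut_size_base (X : {set V}) : cut_size e X = cut_sum adj (fun k => k \in map val (enum X)).
Proof.
rewrite cut_size_sum; apply: eq_bigr => x _; apply: eq_bigr => y _.
by rewrite !(mem_map val_inj) !mem_enum.
Qed.

Let base_snark : essential_snark e.
Proof.
case/and5P: (BP) => _ sf cut col _; split.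
- by move=> x y; rewrite /e (nbsC adjP).
- move=> x; rewrite /deg; have := card_nbs xpredT x; rewrite count_predT.
  by rewrite (size_nbs adjP) // => <-; apply: eq_card => y; rewrite !inE andbT.
- case: (short_freeP adjP sf) => tri sq; split.
  + by move=> x; rewrite /e (nbs_irr adjP).
  + by move=> x y z xy yz zx; apply: (tri x y z).
  + by move=> x y z w xy yz zw wx xz yw; apply: (sq x y z w).
- move=> X X2 Y2; rewrite leqNgt ltnS; apply/negP; rewrite cut_size_base => le3.
  have := cut_searchP adjP cut le3.
  have -> : count id (mkseq (fun k => k \in map val (enum X)) n) = #|X|.
    rewrite count_map -val_enum_ord count_map -size_filter cardE {3}/enum_mem -enumT.
    by congr size; apply: eq_filter => x /=; rewrite (mem_map val_inj) mem_enum.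
  move: (cardsC X); rewrite card_ord; lia.
- move=> [c [cC cP]].
  pose d (k : nat) : V := insubd (Ordinal (leq_trans (isT : 0 < 8) n8)) k.
  pose f i j : nat := if (i < n) && (j < n) then val (c (d i) (d j)) else 0.
  suff : colours_adjacency adj f by move/(colour_searchP adjP col).
  split.
  + by move=> i j; rewrite /f; case: ifP => // _; exact: ltn_ord.
  + by move=> i j; rewrite /f andbC cC.
  + move=> i j k ij ik jk; have /andP[iN jN] := nbs_ltn adjP ij.
    have /andP[_ kN] := nbs_ltn adjP ik; rewrite /f iN jN kN /=.
    by apply: cP; rewrite /e ?val_insubd ?iN ?jN ?kN //; apply: contra jk => /eqP/(congr1 val);
      rewrite !val_insubd jN kN => ->.
Qed.

Let vpar (x : V) : V := insubd x (par x).

Let val_vpar (x : V) : 0 < x -> val (vpar x) = par x /\ (par x \in nbs adj x) && (par x < x).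
Proof.
move=> x0; case/and5P: BP => _ _ _ _ /and4P[/allP/(_ (val x)) + _ _ _].
rewrite mem_iota ltn_ord x0 => /(_ isT)/andP[pn lt]; split; last by rewrite pn.
by rewrite val_insubd (ltn_trans lt (ltn_ord x)).
Qed.

Let vtreeE (x y : V) : parent_rel vpar val x y = parent_rel par id (val x) (val y).
Proof.
by rewrite /parent_rel; congr orb; case: posnP => //= /val_vpar[<- _]; rewrite val_eqE.
Qed.

Let vtree_sub : subrel (parent_rel vpar val) e.
Proof.
move=> x y /orP[] /andP[/val_vpar[E /andP[H _]] /eqP<-]; first by rewrite /e E.
by rewrite /e (nbsC adjP) E.
Qed.

Lemma base_realizable : realizable (map size (base_cycles B)).
Proof.
case/and5P: (BP) => _ _ _ _ /and4P[_ /allP degP /andP[ucs /allP ltcs] /allP cyc].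
pose d (k : nat) : V := insubd (Ordinal (leq_trans (isT : 0 < 8) n8)) k.
have vd k : k < n -> val (d k) = k by move=> kn; rewrite val_insubd kn.
have dv x : d (val x) = x by apply: val_inj; rewrite vd // ltn_ord.
have dinj : {in flatten (base_cycles B) &, injective d}.
  by move=> i j /ltcs/vd E1 /ltcs/vd E2 ij; rewrite -E1 ij.
exists V, e, vpar, val, (map (map d) (base_cycles B)); split.
- exact: base_snark.
- split.
  + by move=> x y x0 y0; apply: val_inj; rewrite x0 y0.
  + by move=> x /val_vpar[E /andP[]]; rewrite /e E.
  + move=> x; have /eqP := degP (val x) ltac:(by rewrite mem_iota ltn_ord).
    rewrite -card_nbs => E; rewrite /deg -map_flatten.
    have -> : (x \in map d (flatten (base_cycles B))) = (val x \in flatten (base_cycles B)).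
      apply/mapP/idP => [[k kc ->]|xc]; first by rewrite vd ?ltcs.
      by exists (val x).
    rewrite -E; apply: eq_card => y; rewrite !inE -vtreeE.
    by apply/idP/andP => [xy|[]//]; split=> //; exact: vtree_sub.
  + by rewrite -map_flatten map_inj_in_uniq.
  + move=> _ /mapP[c ccs ->]; rewrite size_map; have /andP[cycc c3] := cyc _ ccs.
    split=> //; apply: (homo_cycle_in (P := [pred i | i < n]) _ _ cycc).
      move=> i j iN jN /andP[ij tij].
      by rewrite /cotree vtreeE /e !vd // ij.
    by apply/allP => i ic; apply: ltcs; apply/flattenP; exists c.
- by rewrite -map_comp (eq_map (fun c => size_map d c)).
- by rewrite card_ord.
Qed.

End BaseGraph.

(* Found by computer search. *)
Definition base_6 := Base
  [:: [:: 1; 4; 7]; [:: 0; 2; 9]; [:: 1; 3; 6]; [:: 2; 4; 5]; [:: 0; 3; 8]; [:: 3; 7; 9]; [:: 2; 7; 8]; [:: 0; 5; 6]; [:: 4; 6; 9]; [:: 1; 5; 8]]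
  [:: 0; 0; 1; 2; 3; 3; 2; 6; 6; 1]
  [:: [:: 4; 0; 7; 5; 9; 8]].
Definition base_11 := Base
  [:: [:: 1; 8; 13]; [:: 0; 2; 3]; [:: 1; 4; 5]; [:: 1; 6; 7]; [:: 2; 6; 12]; [:: 2; 8; 9]; [:: 3; 4; 8]; [:: 3; 10; 11]; [:: 0; 5; 6]; [:: 5; 17; 18]; [:: 7; 12; 13]; [:: 7; 14; 15]; [:: 4; 10; 19]; [:: 0; 10; 16]; [:: 11; 16; 17]; [:: 11; 18; 19]; [:: 13; 14; 18]; [:: 9; 14; 19]; [:: 9; 15; 16]; [:: 12; 15; 17]]
  [:: 0; 0; 1; 1; 2; 2; 3; 3; 5; 5; 7; 7; 10; 10; 11; 11; 14; 14; 15; 15]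
  [:: [:: 19; 17; 9; 18; 16; 13; 0; 8; 6; 4; 12]].
Definition base_12 := Base
  [:: [:: 1; 14; 15]; [:: 0; 2; 3]; [:: 1; 6; 13]; [:: 1; 4; 7]; [:: 3; 5; 6]; [:: 4; 11; 13]; [:: 2; 4; 10]; [:: 3; 8; 13]; [:: 7; 9; 12]; [:: 8; 10; 11]; [:: 6; 9; 18]; [:: 5; 9; 21]; [:: 8; 18; 20]; [:: 2; 5; 7]; [:: 0; 17; 20]; [:: 0; 16; 19]; [:: 15; 17; 18]; [:: 14; 16; 21]; [:: 10; 12; 16]; [:: 15; 20; 21]; [:: 12; 14; 19]; [:: 11; 17; 19]]
  [:: 0; 0; 1; 1; 3; 4; 4; 3; 7; 8; 9; 9; 8; 7; 0; 0; 15; 16; 16; 15; 19; 19]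
  [:: [:: 12; 20; 14; 17; 21; 11; 5; 13; 2; 6; 10; 18]].
Definition base_5_5 := Base
  [:: [:: 1; 8; 10]; [:: 0; 2; 3]; [:: 1; 4; 5]; [:: 1; 6; 7]; [:: 2; 8; 9]; [:: 2; 10; 17]; [:: 3; 10; 11]; [:: 3; 12; 14]; [:: 0; 4; 17]; [:: 4; 12; 13]; [:: 0; 5; 6]; [:: 6; 14; 16]; [:: 7; 9; 16]; [:: 9; 14; 15]; [:: 7; 11; 13]; [:: 13; 16; 17]; [:: 11; 12; 15]; [:: 5; 8; 15]]
  [:: 0; 0; 1; 1; 2; 2; 3; 3; 4; 4; 6; 6; 9; 9; 13; 13; 15; 15]
  [:: [:: 10; 5; 17; 8; 0]; [:: 11; 16; 12; 7; 14]].
Definition base_5_7 := Base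
  [:: [:: 1; 10; 13]; [:: 0; 2; 3]; [:: 1; 5; 8]; [:: 1; 4; 9]; [:: 3; 5; 6]; [:: 2; 4; 19]; [:: 4; 7; 8]; [:: 6; 20; 21]; [:: 2; 6; 9]; [:: 3; 8; 17]; [:: 0; 11; 12]; [:: 10; 17; 19]; [:: 10; 14; 21]; [:: 0; 14; 15]; [:: 12; 13; 20]; [:: 13; 16; 21]; [:: 15; 17; 18]; [:: 9; 11; 16]; [:: 16; 19; 20]; [:: 5; 11; 18]; [:: 7; 14; 18]; [:: 7; 12; 15]]
  [:: 0; 0; 1; 1; 3; 4; 4; 6; 6; 3; 0; 10; 10; 0; 13; 13; 15; 16; 16; 18; 18; 15]
  [:: [:: 21; 7; 20; 14; 12]; [:: 19; 11; 17; 9; 8; 2; 5]].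
Definition base_7_7 := Base
  [:: [:: 1; 13; 25]; [:: 0; 2; 11]; [:: 1; 3; 4]; [:: 2; 6; 10]; [:: 2; 5; 8]; [:: 4; 6; 7]; [:: 3; 5; 19]; [:: 5; 10; 17]; [:: 4; 9; 10]; [:: 8; 22; 24]; [:: 3; 7; 8]; [:: 1; 12; 15]; [:: 11; 13; 14]; [:: 0; 12; 22]; [:: 12; 24; 25]; [:: 11; 16; 25]; [:: 15; 17; 18]; [:: 7; 16; 23]; [:: 16; 19; 20]; [:: 6; 18; 23]; [:: 18; 21; 24]; [:: 20; 22; 23]; [:: 9; 13; 21]; [:: 17; 19; 21]; [:: 9; 14; 20]; [:: 0; 14; 15]]
  [:: 0; 0; 1; 2; 2; 4; 5; 5; 4; 8; 8; 1; 11; 12; 12; 11; 15; 16; 16; 18; 18; 20; 21; 21; 20; 15]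
  [:: [:: 22; 9; 24; 14; 25; 0; 13]; [:: 19; 23; 17; 7; 10; 3; 6]].
Definition base_8_8 := Base
  [:: [:: 1; 7; 21]; [:: 0; 2; 3]; [:: 1; 6; 18]; [:: 1; 4; 5]; [:: 3; 6; 7]; [:: 3; 8; 9]; [:: 2; 4; 21]; [:: 0; 4; 15]; [:: 5; 10; 11]; [:: 5; 13; 17]; [:: 8; 12; 13]; [:: 8; 14; 15]; [:: 10; 16; 17]; [:: 9; 10; 20]; [:: 11; 18; 19]; [:: 7; 11; 29]; [:: 12; 20; 21]; [:: 9; 12; 27]; [:: 2; 14; 29]; [:: 14; 22; 23]; [:: 13; 16; 26]; [:: 0; 6; 16]; [:: 19; 26; 28]; [:: 19; 24; 25]; [:: 23; 26; 27]; [:: 23; 28; 29]; [:: 20; 22; 24]; [:: 17; 24; 28]; [:: 22; 25; 27]; [:: 15; 18; 25]]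
  [:: 0; 0; 1; 1; 3; 3; 4; 4; 5; 5; 8; 8; 10; 10; 11; 11; 12; 12; 14; 14; 16; 16; 19; 19; 23; 23; 24; 24; 25; 25]
  [:: [:: 17; 9; 13; 20; 26; 22; 28; 27]; [:: 18; 29; 15; 7; 0; 21; 6; 2]].
Definition base_13 := Base
  [:: [:: 1; 10; 11]; [:: 0; 2; 3]; [:: 1; 5; 9]; [:: 1; 4; 7]; [:: 3; 5; 6]; [:: 2; 4; 19]; [:: 4; 9; 13]; [:: 3; 8; 9]; [:: 7; 21; 23]; [:: 2; 6; 7]; [:: 0; 13; 15]; [:: 0; 12; 17]; [:: 11; 13; 14]; [:: 6; 10; 12]; [:: 12; 15; 16]; [:: 10; 14; 21]; [:: 14; 19; 22]; [:: 11; 18; 23]; [:: 17; 19; 20]; [:: 5; 16; 18]; [:: 18; 21; 22]; [:: 8; 15; 20]; [:: 16; 20; 23]; [:: 8; 17; 22]]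
  [:: 0; 0; 1; 1; 3; 4; 4; 3; 7; 7; 0; 0; 11; 12; 12; 14; 14; 11; 17; 18; 18; 20; 20; 17]
  [:: [:: 8; 21; 15; 10; 13; 6; 9; 2; 5; 19; 16; 22; 23]].
Definition base_5_8 := Base
  [:: [:: 1; 8; 22]; [:: 0; 2; 3]; [:: 1; 6; 13]; [:: 1; 4; 5]; [:: 3; 6; 7]; [:: 3; 8; 9]; [:: 2; 4; 8]; [:: 4; 16; 20]; [:: 0; 5; 6]; [:: 5; 10; 11]; [:: 9; 12; 13]; [:: 9; 19; 22]; [:: 10; 14; 15]; [:: 2; 10; 19]; [:: 12; 16; 17]; [:: 12; 18; 19]; [:: 7; 14; 23]; [:: 14; 20; 21]; [:: 15; 20; 23]; [:: 11; 13; 15]; [:: 7; 17; 18]; [:: 17; 22; 23]; [:: 0; 11; 21]; [:: 16; 18; 21]]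
  [:: 0; 0; 1; 1; 3; 3; 4; 4; 5; 5; 9; 9; 10; 10; 12; 12; 14; 14; 15; 15; 17; 17; 21; 21]
  [:: [:: 18; 23; 16; 7; 20]; [:: 22; 11; 19; 13; 2; 6; 8; 0]].
Definition base_6_7 := Base
  [:: [:: 1; 2; 3]; [:: 0; 4; 5]; [:: 0; 6; 7]; [:: 0; 8; 9]; [:: 1; 10; 11]; [:: 1; 7; 9]; [:: 2; 12; 13]; [:: 2; 5; 18]; [:: 3; 14; 15]; [:: 3; 5; 21]; [:: 4; 13; 23]; [:: 4; 12; 14]; [:: 6; 11; 23]; [:: 6; 10; 14]; [:: 8; 11; 13]; [:: 8; 16; 17]; [:: 15; 18; 19]; [:: 15; 21; 22]; [:: 7; 16; 22]; [:: 16; 20; 21]; [:: 19; 22; 23]; [:: 9; 17; 19]; [:: 17; 18; 20]; [:: 10; 12; 20]]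
  [:: 0; 0; 0; 0; 1; 1; 2; 2; 3; 3; 4; 4; 6; 6; 8; 8; 15; 15; 16; 16; 19; 19; 20; 20]
  [:: [:: 12; 23; 10; 13; 14; 11]; [:: 9; 5; 7; 18; 22; 17; 21]].
(** [base_6] is the Petersen graph, the only cubic graph of girth 5 on ten vertices. *)
Lemma realizable_6 : realizable [:: 6].
Proof. by apply: (@base_realizable base_6); vm_compute. Qed.
Lemma realizable_11 : realizable [:: 11].
Proof. by apply: (@base_realizable base_11); vm_compute. Qed.
Lemma realizable_12 : realizable [:: 12].
Proof. by apply: (@base_realizable base_12); vm_compute. Qed.
Lemma realizable_13 : realizable [:: 13].
Proof. by apply: (@base_realizable base_13); vm_compute. Qed.
Lemma realizable_5_5 : realizable [:: 5; 5].
Proof. by apply: (@base_realizable base_5_5); vm_compute. Qed.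
Lemma realizable_5_7 : realizable [:: 5; 7].
Proof. by apply: (@base_realizable base_5_7); vm_compute. Qed.
Lemma realizable_5_8 : realizable [:: 5; 8].
Proof. by apply: (@base_realizable base_5_8); vm_compute. Qed.
Lemma realizable_6_7 : realizable [:: 6; 7].
Proof. by apply: (@base_realizable base_6_7); vm_compute. Qed.
Lemma realizable_7_7 : realizable [:: 7; 7].
Proof. by apply: (@base_realizable base_7_7); vm_compute. Qed.
Lemma realizable_8_8 : realizable [:: 8; 8].
Proof. by apply: (@base_realizable base_8_8); vm_compute. Qed.

(** * Replacing two edges by a 4-pole *)

(* A gadget is a cubic graph on [0, gsize) with four dangling edges, which lead to
   the pendant vertices [gsize + i], i < 4. It replaces two disjoint edges ab and cd
   of a graph: the four dangling edges are attached to a, b, c, d in this order.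
   The inner part of the tree is a forest rooted at a (vertices below [gsplit]) and
   at c (the others), with parents [gpar] of smaller number. If [gpath] is not
   empty, ab must be an edge of an outer cycle, which is rerouted through [gpath];
   otherwise ab is a tree edge. The edge cd is a tree edge in both cases. *)
Record gadget := Gadget {
  gsize : nat;
  gadj : adjacency;
  gpar : seq nat;
  gsplit : nat;
  gpath : seq nat;
  gcycles : seq (seq nat)
}.

Definition port (M : gadget) (i : nat) : nat := nth 0 (nbs (gadj M) (gsize M + i)) 0.

(* [sep] counts the replaced edges ab, cd that a vertex set would have cut. The cut
   of the new graph is that of the old one plus [k - sep], so [sep <= k] handles the
   large sides; the other two clauses handle sets with at most one old vertex. *)
Definition gadget_cut (n : nat) (s : seq bool) (k : nat) : bool :=
  let y := count id (take n s) in let o := nth false (drop n s) in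
  let t := o 0 + o 1 + o 2 + o 3 in
  let sep := (o 0 != o 1) + (o 2 != o 3) in
  [&& sep <= k, (t <= 1) && (0 < y) ==> (sep < k) & (t == 0) ==> (y <= 1)].

(* The dangling edges at a and b get equal colours, as do those at c and d; hence
   a colouring of the new graph induces one of the old graph. *)
Definition gadget_forces (M : gadget) (s : seq nat) : bool :=
  let colour i := nth 3 s (index (port M i, gsize M + i) (edges (gadj M))) in
  (colour 0 == colour 1) && (colour 2 == colour 3).

Definition gadget_graph_ok (M : gadget) : bool :=
  let n := gsize M in let adj := gadj M in
  [&& size adj == n + 4, adjacency_ok n adj, short_free n adj,
      all (fun i => nbs adj (n + i) == [:: port M i]) (iota 0 4)
      && uniq [seq port M i | i <- iota 0 4],
      all (fun i => port M i < n) (iota 0 4),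
      all (fun i => all (fun j => port M j \notin nbs adj (port M i)) [:: 2; 3]) [:: 0; 1],
      cut_search (earlier adj) [::] 0 (gadget_cut n) &
      colour_search (conflicts (edges adj)) [::] (gadget_forces M)].

Section Substitution.
Variables (V : finType) (e : rel V) (a b c d : V) (M : gadget).
Notation n := (gsize M).
Notation adj := (gadj M).
Let W : finType := (V + 'I_n)%type.

Definition outer (i : nat) : V := nth a [:: a; b; c; d] i.

(** Gadget numbers as vertices of the new graph: a pendant vertex is identified with the old vertex
    to which its dangling edge leads. *)
Definition decode (k : nat) : W :=
  if insub k is Some m then inr m else inl (outer (k - n)).

(** The new neighbour of [x] that takes the place of [y]. For fixed [x] this is injective and maps
    the old neighbours onto the new ones, so degrees, colours and tree edges at old vertices are
    transported along it. *)
Definition reroute (x y : V) : W :=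
  if (x == a) && (y == b) then decode (port M 0) else
  if (x == b) && (y == a) then decode (port M 1) else
  if (x == c) && (y == d) then decode (port M 2) else
  if (x == d) && (y == c) then decode (port M 3) else inl y.

Definition subst_rel : rel W := fun u v =>
  match u with
  | inl x => [exists y, e x y && (reroute x y == v)]
  | inr m => v \in map decode (nbs adj m)
  end.

Hypothesis MP : gadget_graph_ok M.
Hypothesis symE : symmetric e.
Hypothesis abcd : uniq [:: a; b; c; d].
Hypothesis eab : e a b.
Hypothesis ecd : e c d.

Let size_adj : size adj = n + 4.
Proof. by case/and5P: MP => /eqP. Qed.

Let adjP : adjacency_ok n adj.
Proof. by case/and5P: MP. Qed.

Lemma port_ltn i : i < 4 -> port M i < n.
Proof.
move=> i4; case/and5P: MP => _ _ _ _ /and4P[/allP/(_ i) H _ _ _].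
by apply: H; rewrite mem_iota.
Qed.

Lemma port_inj i j : i < 4 -> j < 4 -> port M i = port M j -> i = j.
Proof.
case/and5P: MP => _ _ _ /andP[_ u] _ i4 j4 E; apply/eqP.
have sz : size [seq port M i | i <- iota 0 4] = 4 by [].
rewrite -(nth_uniq 0 _ _ u) ?sz // !(nth_map 0) ?size_iota //.
by rewrite !nth_iota ?add0n ?E.
Qed.

Lemma nbs_outer i : i < 4 -> nbs adj (n + i) = [:: port M i].
Proof.
move=> i4; case/and5P: MP => _ _ _ /andP[/allP/(_ i) H _] _.
by apply/eqP/H; rewrite mem_iota.
Qed.

Lemma outer_inj i j : i < 4 -> j < 4 -> outer i = outer j -> i = j.
Proof.
by move=> i4 j4 /eqP; rewrite /outer nth_uniq // => /eqP.
Qed.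

Lemma decode_inner (m : 'I_n) : decode m = inr m.
Proof. by rewrite /decode valK. Qed.

Lemma decode_port i (i4 : i < 4) : decode (port M i) = inr (Ordinal (port_ltn i4)).
Proof. by rewrite -decode_inner. Qed.

Lemma decode_outer i : decode (n + i) = inl (outer i).
Proof. by rewrite /decode insubF ?addKn // ltnNge leq_addr. Qed.

Lemma decode_case k : k < n + 4 ->
  (exists2 m : 'I_n, k = m & decode k = inr m) \/
  (exists2 i, i < 4 /\ k = n + i & decode k = inl (outer i)).
Proof.
move=> kN; case: (ltnP k n) => kn; [left | right].
  by exists (Ordinal kn) => //; rewrite -decode_inner.
exists (k - n); first by rewrite subnKC // ltn_subLR.
by rewrite -decode_outer subnKC.
Qed.

Lemma decode_inj k l : k < n + 4 -> l < n + 4 -> decode k = decode l -> k = l.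
Proof.
move=> /decode_case[[m -> ->]|[i [i4 ->] ->]] /decode_case[[m' -> ->]|[j [j4 ->] ->]] //.
  by case=> ->.
by case=> /outer_inj ->.
Qed.

Lemma nbs_ltn4 m k : k \in nbs adj m -> k < n + 4.
Proof. by move/(nbs_ltn adjP)/andP=> [_]; rewrite size_adj. Qed.

Definition special (x y : V) : bool :=
  (x, y) \in [:: (a, b); (b, a); (c, d); (d, c)].

Definition mate (i : nat) : nat := nth 0 [:: 1; 0; 3; 2] i.

Lemma reroute_special i : i < 4 -> reroute (outer i) (outer (mate i)) = decode (port M i).
Proof.
move: abcd; rewrite /= !inE !negb_or -!andbA.
case/and5P=> /negbTE ab /negbTE ac /negbTE ad /negbTE bc /andP[/negbTE bd /andP[/negbTE cd _]].
have [ba ca da cb] := And4 (etrans (eq_sym b a) ab) (etrans (eq_sym c a) ac) (etrans (eq_sym d a) ad) (etrans (eq_sym c b) bc).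
have [db dc] := conj (etrans (eq_sym d b) bd) (etrans (eq_sym d c) cd).
by case: i => [|[|[|[|i]]]] //= _; rewrite /reroute /outer /mate /= ?eqxx ?ab ?ac ?ad ?bc ?bd ?cd ?ba ?ca ?da ?cb ?db ?dc.
Qed.

Lemma specialP x y :
  reflect (exists2 i, i < 4 & x = outer i /\ y = outer (mate i)) (special x y).
Proof.
apply: (iffP idP) => [|[[|[|[|[|i]]]] // _ [-> ->]]]; rewrite /special !inE ?eqxx ?orbT //.
by case/or4P=> /eqP[-> ->]; [exists 0 | exists 1 | exists 2 | exists 3].
Qed.

Lemma reroute_plain x y : ~~ special x y -> reroute x y = inl y.
Proof.
rewrite /special !inE !xpair_eqE !negb_or /reroute.
by case/and4P=> /negbTE-> /negbTE-> /negbTE-> /negbTE->.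
Qed.

Lemma special_edge x y : special x y -> e x y.
Proof. by rewrite /special !inE => /or4P[] /eqP[-> ->] //; rewrite symE. Qed.

Lemma specialC x y : special x y = special y x.
Proof.
rewrite /special !inE !xpair_eqE.
by rewrite ![(y == _) && (x == _)]andbC orbCA; congr [|| _, _ | _]; rewrite orbC.
Qed.

Lemma mate_lt i : i < 4 -> mate i < 4.
Proof. by case: i => [|[|[|[|]]]]. Qed.

Lemma reroute_inj x : injective (reroute x).
Proof.
move=> y z; case: (boolP (special x y)) => [/specialP[i i4 [xi ->]]|sy];
  case: (boolP (special x z)) => [/specialP[j j4 [xj ->]]|sz].
- by rewrite (outer_inj i4 j4 (etrans (esym xi) xj)).
- by rewrite (reroute_plain sz) xi reroute_special // (decode_port i4).
- by rewrite (reroute_plain sy) xj reroute_special // (decode_port j4).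
- by rewrite (reroute_plain sy) (reroute_plain sz) => -[].
Qed.

Lemma subst_reroute x y : e x y -> subst_rel (inl x) (reroute x y).
Proof. by move=> xy; apply/existsP; exists y; rewrite xy /=. Qed.

Lemma substLL x y : subst_rel (inl x) (inl y) = e x y && ~~ special x y.
Proof.
apply/existsP/andP => [[z /andP[xz /eqP]]|[xy sp]]; last first.
  by exists y; rewrite xy reroute_plain /=.
case: (boolP (special x z)) => [/specialP[i i4 [-> ->]]|sz].
  by rewrite reroute_special // (decode_port i4).
by rewrite reroute_plain // => -[<-].
Qed.

Lemma substLR x (m : 'I_n) :
  reflect (exists2 i, i < 4 & x = outer i /\ m = port M i :> nat) (subst_rel (inl x) (inr m)).
Proof.
apply: (iffP existsP) => [[y /andP[xy /eqP]]|[i i4 [-> mi]]].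
  case: (boolP (special x y)) => [/specialP[i i4 [-> ->]]|sy]; last by rewrite reroute_plain.
  rewrite reroute_special // (decode_port i4).
  by case=> <-; exists i.
exists (outer (mate i)); rewrite reroute_special // -mi decode_inner eqxx andbT.
by apply: special_edge; apply/specialP; exists i.
Qed.

Lemma substRL x (m : 'I_n) :
  reflect (exists2 i, i < 4 & x = outer i /\ m = port M i :> nat) (subst_rel (inr m) (inl x)).
Proof.
apply: (iffP mapP) => [[k kadj]|[i i4 [-> mi]]].
  case: (decode_case (nbs_ltn4 kadj)) => [[l _ ->]|[i [i4 Ek] ->]] //.
  case=> ->; exists i => //; split=> //.
  by move: kadj; rewrite Ek (nbsC adjP) nbs_outer // inE => /eqP.
by exists (n + i); rewrite ?decode_outer // (nbsC adjP) nbs_outer // mi mem_head.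
Qed.

Lemma substRR (m k : 'I_n) : subst_rel (inr m) (inr k) = ((k : nat) \in nbs adj m).
Proof.
apply/mapP/idP => [[j jadj]|kadj]; last by exists (k : nat); rewrite ?decode_inner.
case: (decode_case (nbs_ltn4 jadj)) => [[l Ej ->]|[i _ ->]] // [->].
by rewrite -Ej.
Qed.

Lemma subst_sym : symmetric subst_rel.
Proof.
move=> [x|m] [y|k].
- by rewrite !substLL symE specialC.
- by apply/substLR/substRL.
- by apply/substRL/substLR.
- by rewrite !substRR (nbsC adjP).
Qed.

Lemma subst_rowL x (p : pred W) :
  #|[set v | subst_rel (inl x) v & p v]| = #|[set y | e x y & p (reroute x y)]|.
Proof.
rewrite -(card_imset _ (@reroute_inj x)); apply: eq_card => v.
rewrite inE; apply/andP/imsetP => [[/existsP[y /andP[xy /eqP<-]] pv]|[y]].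
  by exists y; rewrite // inE xy.
by rewrite inE => /andP[xy pv ->]; rewrite subst_reroute.
Qed.

Lemma subst_rowR (m : 'I_n) (p : pred W) :
  #|[set v | subst_rel (inr m) v & p v]| = count (fun k => p (decode k)) (nbs adj m).
Proof.
have dinj : {in nbs adj m &, injective decode}.
  by move=> k l /nbs_ltn4 k4 /nbs_ltn4 l4; apply: decode_inj.
rewrite -[RHS]count_map -size_filter.
rewrite -(card_uniqP _); last by rewrite filter_uniq // map_inj_in_uniq ?(nbs_uniq adjP).
by apply: eq_card => v; rewrite inE mem_filter andbC.
Qed.

Lemma subst_cubic : cubic e -> cubic subst_rel.
Proof.
move=> cub [x|m].
  have := subst_rowL x xpredT; rewrite /deg; under eq_finset do rewrite andbT.
  by move=> ->; rewrite -(cub x); apply: eq_card => y; rewrite !inE andbT.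
have := subst_rowR m xpredT; rewrite count_predT (size_nbs adjP) ?size_adj ?leq_addr //.
by rewrite /deg => <-; apply: eq_card => y; rewrite !inE andbT.
Qed.

(** Distinct ports have distinct outer ends, so a short cycle that uses both old and inner vertices
    must be a 4-cycle through an old edge between two of a, b, c, d and an edge between their ports.
    For the ends of a replaced edge the old edge is gone; for ends of different replaced edges the
    ports are not adjacent by [gadget_graph_ok]. *)
Lemma subst_short : no_short_cycle e -> no_short_cycle subst_rel.
Proof.
case=> irr tri sq.
case/and5P: (MP) => _ _ sf _ /and4P[_ /allP pp _ _].
case: (short_freeP adjP sf) => mtri msq.
have LRLR x y m : subst_rel (inl x) (inr m) -> subst_rel (inr m) (inl y) -> x = y.
  move=> /substLR[i i4 [-> mi]] /substRL[j j4 [-> mj]].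
  by rewrite (port_inj i4 j4) // -mi.
have RLR x m k : subst_rel (inr m) (inl x) -> subst_rel (inl x) (inr k) -> m = k.
  move=> /substRL[i i4 [-> mi]] /substLR[j j4 [/(outer_inj i4 j4) ij kj]].
  by apply: val_inj; rewrite /= mi kj ij.
have LL x y : subst_rel (inl x) (inl y) -> e x y by rewrite substLL => /andP[].
have far x y m k : subst_rel (inl x) (inl y) -> subst_rel (inl y) (inr k) ->
    subst_rel (inr k) (inr m) -> subst_rel (inr m) (inl x) -> False.
  rewrite substLL => /andP[_ sp] /substLR[j j4 [yj kj]]; rewrite substRR kj.
  move=> madj /substRL[i i4 [xi mi]]; move: sp madj; rewrite mi xi yj.
  have mm k1 k2 : k1 \in [:: 0; 1] -> k2 \in [:: 2; 3] ->
      port M k2 \in nbs adj (port M k1) -> False.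
    by move=> /pp/allP H /H /negP.
  case: (ltnP i 2) => i2; case: (ltnP j 2) => j2 sp.
  - case: (altP (i =P j)) => [->|ij]; first by rewrite (nbs_irr adjP).
    by case/negP: sp; apply/specialP; exists i => //; split=> //; congr outer;
      move: i i2 j j2 ij {i4 j4 xi mi yj kj} => [|[|]] // _ [|[|]].
  - by rewrite (nbsC adjP); apply: mm; rewrite !inE; lia.
  - by apply: mm; rewrite !inE; lia.
  - case: (altP (i =P j)) => [->|ij]; first by rewrite (nbs_irr adjP).
    by case/negP: sp; apply/specialP; exists i => //; split=> //; congr outer;
      move: i i2 i4 j j2 j4 ij {xi mi yj kj} => [|[|[|[|]]]] // _ _ [|[|[|[|]]]].
split.
- by move=> [x|m]; rewrite ?substLL ?irr // substRR (nbs_irr adjP).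
- have LLR x y m : subst_rel (inl x) (inl y) -> subst_rel (inl y) (inr m) ->
      subst_rel (inr m) (inl x) -> False.
    by move=> /LL xy ym mx; rewrite (LRLR _ _ _ ym mx) irr in xy.
  have LRR x m k : subst_rel (inl x) (inr m) -> subst_rel (inr m) (inr k) ->
      subst_rel (inr k) (inl x) -> False.
    by move=> xm mk kx; rewrite (RLR _ _ _ kx xm) substRR (nbs_irr adjP) in mk.
  move=> [x|m] [y|k] [z|l].
  + by move=> /LL xy /LL yz /LL; apply: (tri x y z).
  + exact: LLR.
  + by move=> xk kz zx; apply: (LLR _ _ _ zx xk kz).
  + exact: LRR.
  + by move=> my yz zm; apply: (LLR _ _ _ yz zm my).
  + by move=> my yl lm; apply: (LRR _ _ _ yl lm my).
  + by move=> mk kz zm; apply: (LRR _ _ _ zm mk kz).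
  + by rewrite !substRR; apply: mtri.
- move=> [x|m] [y|k] [z|l] [w|q] E1 E2 E3 E4 ne1 ne2.
  + exact: (sq x y z w (LL _ _ E1) (LL _ _ E2) (LL _ _ E3) (LL _ _ E4)).
  + by rewrite (LRLR _ _ _ E3 E4) eqxx in ne1.
  + by rewrite (LRLR _ _ _ E2 E3) eqxx in ne2.
  + exact: (far _ _ _ _ E1 E2 E3 E4).
  + by rewrite (LRLR _ _ _ E1 E2) eqxx in ne1.
  + by rewrite (LRLR _ _ _ E1 E2) eqxx in ne1.
  + exact: (far _ _ _ _ E4 E1 E2 E3).
  + by rewrite (RLR _ _ _ E4 E1) eqxx in ne2.
  + by rewrite (LRLR _ _ _ E4 E1) eqxx in ne2.
  + exact: (far _ _ _ _ E2 E3 E4 E1).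
  + by rewrite (RLR _ _ _ E1 E2) eqxx in ne1.
  + by rewrite (RLR _ _ _ E1 E2) eqxx in ne1.
  + exact: (far _ _ _ _ E3 E4 E1 E2).
  + by rewrite (RLR _ _ _ E2 E3) eqxx in ne2.
  + by rewrite (RLR _ _ _ E3 E4) eqxx in ne1.
  + by apply: (msq m k l q); rewrite -?substRR.
Qed.

(** The old edge xy takes the colour of the new edge from [x] to [reroute x y]. This is proper by
    injectivity, and symmetric because the gadget forces equal colours at the two ends of a replaced
    edge. *)
Lemma subst_colour :
  ~ three_edge_colourable e -> ~ three_edge_colourable subst_rel.
Proof.
move=> col [f [fC fP]]; apply: col.
(* The colours seen inside the gadget. A pendant vertex has a single edge there, so it imposes no
   condition. *)
pose g i j : nat := if (i < n + 4) && (j < n + 4) then val (f (decode i) (decode j)) else 0.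
have gP : colours_adjacency adj g.
  split.
  - by move=> i j; rewrite /g; case: ifP => // _; exact: ltn_ord.
  - by move=> i j; rewrite /g andbC fC.
  - move=> i j k ij ik jk.
    have iN : i < n + 4 by have /andP[] := nbs_ltn adjP ij; rewrite size_adj.
    have jN := nbs_ltn4 ij; have kN := nbs_ltn4 ik.
    rewrite /g iN jN kN /=.
    case: (decode_case iN) => [[m Em Ed]|[l [l4 El] _]]; last first.
      by move: ij ik jk; rewrite El nbs_outer // !inE => /eqP-> /eqP->; rewrite eqxx.
    have neq : decode j != decode k by apply: contra jk => /eqP/decode_inj->.
    by apply: fP => //; rewrite Ed /= map_f // -Em.
case/and5P: (MP) => _ _ _ _ /and4P[_ _ _ cs].
have := colour_searchP adjP cs gP; rewrite /gadget_forces.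
set E := edges adj.
have pE i : i < 4 -> nth 3 [seq g x.1 x.2 | x <- E] (index (port M i, n + i) E) =
    val (f (inl (outer i)) (decode (port M i))).
  move=> i4; have iE : (port M i, n + i) \in E.
    apply: (edges_mem adjP); last by rewrite (leq_trans (port_ltn i4)) ?leq_addr.
    by rewrite (nbsC adjP) nbs_outer // mem_head.
  rewrite (nth_map (0, 0)) ?index_mem // nth_index // /g /=.
  by rewrite ltn_add2l i4 (leq_trans (port_ltn i4)) ?leq_addr // decode_outer fC.
rewrite !pE // => /andP[/eqP/val_inj F1 /eqP/val_inj F2].
have mateF i : i < 4 -> f (inl (outer i)) (decode (port M i)) =
    f (inl (outer (mate i))) (decode (port M (mate i))).
  by case: i => [|[|[|[|i]]]] //= _; rewrite /mate /= ?F1 ?F2.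
exists (fun x y => f (inl x) (reroute x y)); split=> [x y|x y z xy xz yz]; last first.
  apply: fP; rewrite ?subst_reroute //.
  by apply: contra yz => /eqP/reroute_inj->.
case: (boolP (special x y)) => [sp|sp].
  have := sp; rewrite specialC; case/specialP: sp => i i4 [-> ->] _.
  rewrite reroute_special // mateF //; congr f.
  have -> : outer i = outer (mate (mate i)) by case: i i4 => [|[|[|[|]]]].
  by rewrite reroute_special // mate_lt.
by rewrite !reroute_plain // 1?specialC.
Qed.

Let memX (X : {set W}) (k : nat) : bool := decode k \in X.

(** The sums differ only in the four ordered pairs of ends of replaced edges; adding the missing
    terms on both sides avoids truncated subtraction. *)
Lemma big_special (F F' : V -> V -> nat) :
  (forall x y, ~~ special x y -> F x y = F' x y) ->
  \sum_x \sum_y F x y + (F' a b + F' b a + F' c d + F' d c) =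
  \sum_x \sum_y F' x y + (F a b + F b a + F c d + F d c).
Proof.
move=> FF'; rewrite !pair_bigA /=.
pose sp := [:: (a, b); (b, a); (c, d); (d, c)].
have usp : uniq sp.
  move: abcd; rewrite /= !inE !negb_or !xpair_eqE -!andbA => /and5P[ab ac ad bc /and3P[bd cd _]].
  by rewrite (negbTE ab) (negbTE ac) (negbTE ad) (negbTE bc) (negbTE bd) (negbTE cd) !andbF !andbT /=
    ?(eq_sym b a) ?(negbTE ab) ?(eq_sym c a) ?(negbTE ac).
have split4 G : \sum_(p : V * V) G p.1 p.2 =
    G a b + G b a + G c d + G d c + \sum_(p | p \notin sp) G p.1 p.2.
  rewrite (bigID (mem sp)) /= -big_uniq //= !big_cons big_nil /=; lia.
rewrite (split4 F) (split4 F').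
have -> : \sum_(p | p \notin sp) F p.1 p.2 = \sum_(p | p \notin sp) F' p.1 p.2.
  by apply: eq_bigr => -[x y] /= /FF'.
lia.
Qed.

(** Each new edge is either an old one other than ab and cd or an edge of the gadget, pendant edges
    included, with pendant vertices on the side of a, b, c, d. So the right side exceeds the new cut
    by ab and cd, as far as these are cut. *)
Lemma cut_subst (X : {set W}) (XG : {set V}) : XG = [set x | inl x \in X] ->
  cut_size subst_rel X + ((a \in XG) != (b \in XG)) + ((c \in XG) != (d \in XG)) =
  cut_size e XG + cut_sum adj (memX X).
Proof.
move=> ->; set G := [set x | inl x \in X].
pose F' x y : nat := e x y && (x \in G) && (reroute x y \notin X).
pose F x y : nat := e x y && (x \in G) && (y \notin G).
have -> : cut_size subst_rel X = \sum_x \sum_y F' x y +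
    \sum_(m < n) \sum_(k < n + 4) ((val k \in nbs adj m) && memX X m && ~~ memX X k).
  rewrite cut_size_sum big_sumType /=; congr (_ + _); apply: eq_bigr.
    move=> x _; pose p v := (inl x \in X) && (v \notin X).
    have := subst_rowL x p; rewrite !card_set_sum /= => E.
    transitivity (\sum_v (subst_rel (inl x) v && p v : nat)).
      by apply: eq_bigr => v _; rewrite andbA.
    by rewrite E; apply: eq_bigr => y _; rewrite /p /F' inE andbA.
  move=> m _; pose p v := (inr m \in X) && (v \notin X).
  have := subst_rowR m p; rewrite !card_set_sum /= => E.
  transitivity (\sum_v (subst_rel (inr m) v && p v : nat)).
    by apply: eq_bigr => v _; rewrite andbA.
  have nE : [seq k <- nbs adj m | k < n + 4] = nbs adj m.
    by apply/all_filterP/allP => k /nbs_ltn4.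
  rewrite E -nE -(@sum_mem_count (fun k => p (decode k))) ?(nbs_uniq adjP) // nE.
  by apply: eq_bigr => k _; rewrite /p /memX decode_inner andbA.
have -> : cut_size e G = \sum_x \sum_y F x y by rewrite cut_size_sum.
rewrite /cut_sum size_adj big_split_ord /=.
have row i : i < 4 ->
    \sum_(k < n + 4) ((val k \in nbs adj (n + i)) && memX X (n + i) && ~~ memX X k) =
    F' (outer i) (outer (mate i)).
  move=> i4; rewrite nbs_outer // /F' inE /memX decode_outer reroute_special //.
  have -> /= : e (outer i) (outer (mate i)) by apply: special_edge; apply/specialP; exists i.
  have pN : port M i < n + 4 by rewrite (leq_trans (port_ltn i4)) ?leq_addr.
  rewrite (bigD1 (Ordinal pN)) //= mem_head big1 ?addn0 // => k kne.
  by have /negbTE-> : nat_of_ord k \notin [:: port M i] by rewrite inE.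
rewrite !big_ord_recr big_ord0 /= !row //.
have FF' x y : ~~ special x y -> F' x y = F x y.
  by move=> sp; rewrite /F' /F reroute_plain // !inE.
have := big_special FF'.
have -> : F a b + F b a + F c d + F d c =
    ((a \in G) != (b \in G)) + ((c \in G) != (d \in G)).
  rewrite /F eab ecd (symE b) eab (symE d) ecd /=.
  by case: (a \in G); case: (b \in G); case: (c \in G); case: (d \in G).
rewrite /outer /mate /=; lia.
Qed.

Lemma cut_size1 v : irreflexive e -> cubic e -> cut_size e [set v] = 3.
Proof.
move=> irr cub; rewrite cut_size_sum (bigD1 v) //= [X in _ + X]big1 ?addn0; last first.
  by move=> x /negbTE xv; apply: big1 => y _; rewrite inE xv andbF.
rewrite -(cub v) /deg card_set_sum; apply: eq_bigr => y _.
rewrite !inE eqxx andbT; case: (altP (y =P v)) => [->|]; by rewrite ?irr ?andbT.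
Qed.

Lemma subst_ess4 : irreflexive e -> cubic e -> ess4_connected e ->
  ess4_connected subst_rel.
Proof.
move=> irr cub ess.
pose XG (X : {set W}) := [set x | inl x \in X].
pose y (X : {set W}) := #|[set m : 'I_n | inr m \in X]|.
have cardX (X : {set W}) : #|X| = #|XG X| + y X.
  rewrite -sum1_card big_mkcond /= big_sumType /= /XG /y !card_set_sum.
  by congr (_ + _); apply: eq_bigr => v _; case: (_ \in X).
pose t X := (a \in XG X) + (b \in XG X) + (c \in XG X) + (d \in XG X).
pose sep X := ((a \in XG X) != (b \in XG X)) + ((c \in XG X) != (d \in XG X)).
have gcut X : cut_sum adj (memX X) <= 3 ->
    [&& sep X <= cut_sum adj (memX X),
     (t X <= 1) && (0 < y X) ==> (sep X < cut_sum adj (memX X)) &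
     (t X == 0) ==> (y X <= 1)].
  case/and5P: (MP) => _ _ _ _ /and4P[_ _ cs _] le3.
  have := cut_searchP adjP cs le3; rewrite /gadget_cut size_adj.
  have -> : count id (take n (mkseq (memX X) (n + 4))) = y X.
    rewrite /mkseq -map_take take_iota (minn_idPl (leq_addr _ _)) count_map.
    rewrite -val_enum_ord count_map -size_filter /y cardE {2}/enum_mem -enumT.
    by congr size; apply: eq_filter => m /=; rewrite /memX decode_inner inE.
  by rewrite !nth_drop !nth_mkseq ?ltn_add2l // /memX !decode_outer /outer /t /sep /XG !inE.
have sep2 X : sep X <= 2.
  by rewrite /sep; case: (_ != _); case: (_ != _).
have tle X : t X <= #|XG X|.
  have -> : t X = size [seq v <- [:: a; b; c; d] | v \in XG X].
    by rewrite size_filter /= addn0 !addnA.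
  rewrite -(card_uniqP (filter_uniq _ abcd)); apply: subset_leq_card.
  by apply/subsetP => v; rewrite mem_filter => /andP[].
(* A single old vertex contributes 3 to the old cut and an empty old part contributes 0; the clauses
   of [gadget_cut] supply the rest. Sets that miss at most one old vertex are treated through their
   complements. *)
have key (X : {set W}) : 2 <= #|X| -> #|XG X| <= 1 -> 4 <= cut_size subst_rel X.
  move=> X2 G1; have := cut_subst (erefl (XG X)); rewrite -addnA -/(sep X).
  have tX := tle X; have cX := cardX X; have gX := gcut X; have sX := sep2 X.
  case: (posnP #|XG X|) => [G0|Gpos].
    have E : XG X = set0 by apply/eqP; rewrite -cards_eq0 G0.
    have -> : cut_size e (XG X) = 0.
      by rewrite cut_size_sum E; apply: big1 => x _; apply: big1 => z _; rewrite inE andbF.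
    have -> : sep X = 0 by rewrite /sep E !inE.
    case: (leqP (cut_sum adj (memX X)) 3) => [/gX|]; last by lia.
    have -> : t X = 0 by lia.
    by case/and3P=> _ _ /= y1; lia.
  have /cards1P[v E] : #|XG X| == 1 by lia.
  have -> : cut_size e (XG X) = 3 by rewrite E cut_size1.
  case: (leqP (cut_sum adj (memX X)) 3) => [/gX|]; last by lia.
  have -> : t X <= 1 by lia.
  have -> /= : 0 < y X by lia.
  by case/and3P=> _ lt _; lia.
move=> X X2 Y2; case: (leqP #|XG X| 1) => [/key->//|G2].
have EC : XG (~: X) = ~: XG X by apply/setP => x; rewrite !inE.
case: (leqP #|~: XG X| 1) => [|H2].
  by rewrite -EC -(cut_sizeC X subst_sym) => /key->.
have := ess _ G2 H2; have := cut_subst (erefl (XG X)); rewrite -addnA -/(sep X).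
case: (leqP (cut_sum adj (memX X)) 3) => [/gcut/and3P[le _ _]|]; first lia.
by move: (sep2 X); lia.
Qed.

Lemma subst_essential_snark : essential_snark e -> essential_snark subst_rel.
Proof.
case=> _ cub short ess col; split.
- exact: subst_sym.
- exact: subst_cubic.
- exact: subst_short.
- by apply: subst_ess4 => //; case: short.
- exact: subst_colour.
Qed.

End Substitution.

(** * Extending the hist through the 4-pole *)

(** [gpar] yields all tree edges except the pendant ones at b and d: there the old vertex is the
    child, so they are listed separately. *)
Definition gadget_tree (M : gadget) (j k : nat) : bool :=
  let n := gsize M in let par := nth 0 (gpar M) in
  [|| (j < n) && (par j == k), (k < n) && (par k == j),
      ((j == n + 1) || (k == n + 1)) && nilp (gpath M) |
      (j == n + 3) || (k == n + 3)].

Definition gadget_cotree (M : gadget) (j k : nat) : bool :=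
  (k \in nbs (gadj M) j) && ~~ gadget_tree M j k.

(** Pendant edges keep the tree status of the edges they replace. If ab is a tree edge, b must hang
    below the part rooted at a, for its parent to have a rank based on a. Otherwise a is a leaf, so
    nothing is rooted there and [gsplit] is 0, and the cotree path leads from the pendant vertex of
    a to that of b. *)
Definition gadget_hist_ok (M : gadget) : bool :=
  let n := gsize M in let par := nth 0 (gpar M) in
  let cov := gpath M ++ flatten (gcycles M) in
  [&& all (fun m => (par m \in nbs (gadj M) m) &&
        if par m < n then (par m < m) && ((par m < gsplit M) == (m < gsplit M))
        else par m == (if m < gsplit M then n else n + 2)) (iota 0 n),
      (par (port M 0) == n) == nilp (gpath M), par (port M 2) == n + 2,
      all (fun m => count (gadget_tree M m) (nbs (gadj M) m) ==
                    if m \in cov then 1 else 3) (iota 0 n),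
      uniq cov && all (fun m => m < n) cov,
      all (fun c => cycle (gadget_cotree M) c && (2 < size c)) (gcycles M) &
      if nilp (gpath M) then port M 1 < gsplit M
      else (gsplit M == 0) && path (gadget_cotree M) n (rcons (gpath M) (n + 1))].

Section SubstTree.
Variables (V : finType) (e : rel V) (a b c d : V) (M : gadget).
Variables (par : V -> V) (rk : V -> nat) (cs : seq (seq V)).
Notation n := (gsize M).
Notation adj := (gadj M).
Notation gp := (nth 0 (gpar M)).
Hypothesis MG : gadget_graph_ok M.
Hypothesis MT : gadget_hist_ok M.
Hypothesis symE : symmetric e.
Hypothesis abcd : uniq [:: a; b; c; d].
Hypothesis eab : e a b.
Hypothesis rh : rooted_hist e par rk cs.
Hypothesis rkd : 0 < rk d.
Hypothesis pard : par d = c.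
Hypothesis parb : (0 < rk b) && (par b == a) = nilp (gpath M).
Hypothesis para : (0 < rk a) && (par a == b) = false.
(** The port of d may lie in the part rooted at a. Then d becomes a descendant of a, which the ranks
    allow only if a has smaller rank than d. *)
Hypothesis rkad : 0 < gsplit M -> rk a < rk d.
Let W : finType := (V + 'I_n)%type.
Notation T := (parent_rel par rk).
Let dec : nat -> W := decode a b c d M.
Let rr : V -> V -> W := reroute a b c d M.
Let e' : rel W := @subst_rel V e a b c d M.
Let out := outer a b c d.

Let ecd : e c d.
Proof. by rewrite symE -pard; case: (rh_par rh rkd). Qed.

Let adjP : adjacency_ok n adj.
Proof. by case/and5P: MG. Qed.

Let ltcd : rk c < rk d.
Proof. by rewrite -pard; case: (rh_par rh rkd). Qed.

Definition subst_par (u : W) : W :=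
  match u with inl x => rr x (par x) | inr m => dec (gp m) end.

(** Scaling by [n.+1] opens [n] free ranks above each old one; the inner vertices of a part use
    those just above its root, in the order of their numbers. *)
Definition subst_rk (u : W) : nat :=
  match u with
  | inl x => n.+1 * rk x
  | inr m => n.+1 * rk (if m < gsplit M then a else c) + m.+1
  end.

Notation T' := (parent_rel subst_par subst_rk).

Let gparP (m : nat) : m < n -> gp m \in nbs adj m /\
  if gp m < n then (gp m < m) && ((gp m < gsplit M) == (m < gsplit M))
        else gp m == (if m < gsplit M then n else n + 2).
Proof.
move=> mn; case/and3P: MT => /allP/(_ m) + _ _.
by rewrite mem_iota mn => /(_ isT)/andP[].
Qed.

Let gp_case (m : 'I_n) :
  [\/ exists2 k : 'I_n, gp m = k & (k < m) && ((k < gsplit M) == (m < gsplit M)),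
      gp m = n /\ m < gsplit M | gp m = n + 2 /\ gsplit M <= m].
Proof.
case: (gparP (ltn_ord m)) => _; case: ltnP => [lt H|_].
  by constructor 1; exists (Ordinal lt).
by case: ltnP => ms /eqP E; [constructor 2 | constructor 3].
Qed.

Let srk_inl x : (0 < subst_rk (inl x)) = (0 < rk x).
Proof. by rewrite /= muln_gt0. Qed.

Let dec_inner (m : 'I_n) : dec m = inr m.
Proof. exact: decode_inner. Qed.

Let dec_outer i : dec (n + i) = inl (out i).
Proof. exact: decode_outer. Qed.

Let dec_eq k l : k < n + 4 -> l < n + 4 -> (dec k == dec l) = (k == l).
Proof. by move=> kN lN; apply/eqP/eqP => [/decode_inj->|->]. Qed.

Let gpN (m : 'I_n) : gp m < n + 4.
Proof. by case: (gparP (ltn_ord m)) => /(nbs_ltn4 MG). Qed.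

Let T'LR x (m : 'I_n) : T' (inl x) (inr m) =
  (0 < rk x) && (rr x (par x) == inr m) || (dec (gp m) == inl x).
Proof. by rewrite /parent_rel srk_inl /= addnS. Qed.

(** Since rerouting preserves tree status, old vertices keep their tree degree; in particular leaves
    stay leaves. *)
Lemma subst_treeL x y : e x y -> T' (inl x) (rr x y) = T x y.
Proof.
move=> xy; case: (boolP (special a b c d x y)) => [sp|sp]; last first.
  have Ey : rr x y = inl y by exact: reroute_plain.
  have Ex : rr y x = inl x by apply: reroute_plain; rewrite specialC.
  rewrite {1}Ey /parent_rel !srk_inl /=.
  by rewrite -{1}Ey -Ex !(inj_eq (@reroute_inj _ _ _ _ _ _ MG abcd _)).
have := sp; case/specialP: sp => i i4 [-> ->] _.
have Er : rr (out i) (out (mate i)) = inr (Ordinal (port_ltn MG i4)).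
  by rewrite -(decode_port a b c d MG i4); apply: reroute_special.
rewrite /out in Er; rewrite Er T'LR -Er /rr (inj_eq (@reroute_inj _ _ _ _ _ _ MG abcd _)) /=.
case/and4P: MT => _ /eqP p0 /eqP p2 _.
have [ab [cd dc]] : T a b = nilp (gpath M) /\ T c d /\ T d c.
  by rewrite /parent_rel rkd pard eqxx para -parb orbT.
have cd' : (0 < rk c) && (par c == d) = false.
  apply/negP => /andP[c0 /eqP E]; have [_] := rh_par rh c0; rewrite E => lt.
  by have := ltn_trans lt ltcd; rewrite ltnn.
have pN := port_ltn MG.
clear Er; move: i4; case: i => [|[|[|[|i]]]] //= i4; rewrite /outer /mate /=.
- rewrite para ab -p0 -[inl a]/(inl (out 0)) -dec_outer.
  by rewrite (dec_eq (gpN (Ordinal (pN _ i4)))) ?ltn_add2l //= addn0.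
- rewrite (parent_relC par rk b a) ab parb -[inl b]/(inl (out 1)) -dec_outer.
  rewrite (dec_eq (gpN (Ordinal (pN _ i4)))) ?ltn_add2l //=.
  case: (gp_case (Ordinal (pN _ i4))) => /= [[k -> _]|[-> _]|[-> _]].
  + by rewrite ltn_eqF ?orbF // (leq_trans (ltn_ord k)) ?leq_addr.
  + by rewrite -[X in X == _]addn0 eqn_add2l orbF.
  + by rewrite eqn_add2l orbF.
- rewrite cd' cd -[inl c]/(inl (out 2)) -dec_outer.
  by rewrite (dec_eq (gpN (Ordinal (pN _ i4)))) ?ltn_add2l //= p2 eqxx.
- by rewrite rkd pard eqxx dc.
Qed.

Lemma gadget_treeC j k : gadget_tree M j k = gadget_tree M k j.
Proof.
rewrite /gadget_tree orbCA [(j == n + 1) || _]orbC [(j == n + 3) || _]orbC.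
by congr [|| _, _ | _].
Qed.

Lemma subst_treeR (m : 'I_n) k : k \in nbs adj m -> T' (inr m) (dec k) = gadget_tree M m k.
Proof.
move=> kadj; have kN := nbs_ltn4 MG kadj.
case: (decode_case a b c d kN) => [[l Ek _]|[i [i4 Ek] _]].
  rewrite Ek dec_inner /parent_rel /= !addnS /= /gadget_tree !ltn_ord /=.
  have lt4 (l' : 'I_n) : l' < n + 4 by rewrite (leq_trans (ltn_ord l')) ?leq_addr.
  have nout (l' : 'I_n) i : (nat_of_ord l' == n + i) = false.
    by rewrite ltn_eqF // (leq_trans (ltn_ord l')) ?leq_addr.
  by rewrite -!dec_inner !dec_eq // !nout /= !orbF.
have mi : nat_of_ord m = port M i.
  by move: kadj; rewrite Ek (nbsC adjP) (nbs_outer MG) // inE => /eqP.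
have -> : inr m = rr (out i) (out (mate i)).
  by rewrite /rr /out reroute_special // -mi; apply/esym/dec_inner.
rewrite Ek dec_outer parent_relC subst_treeL; last first.
  by apply: (special_edge symE eab ecd); apply/specialP; exists i.
case/and4P: MT => _ /eqP p0 /eqP p2 _.
have mN : (m == n + 1 :> nat) = false /\ (m == n + 3 :> nat) = false.
  by split; rewrite ltn_eqF // (leq_trans (ltn_ord m)) ?leq_addr.
rewrite /gadget_tree ltn_ord mN.1 mN.2 ltnNge leq_addr /= mi.
rewrite !eqn_add2l /parent_rel.
have cd' : (0 < rk c) && (par c == d) = false.
  apply/negP => /andP[c0 /eqP E]; have [_] := rh_par rh c0; rewrite E => lt.
  by have := ltn_trans lt ltcd; rewrite ltnn.
move: i4 mi {kadj kN}; case: i {Ek} => [|[|[|[|i]]]] //= _ mi; rewrite /out /outer /mate /=.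
- by rewrite para parb -p0 addn0 orbF.
- rewrite para parb orbF -mi; case: (gp_case m) => [[l -> _]|[-> _]|[-> _]].
  + by rewrite ltn_eqF ?orbT ?orbF // (leq_trans (ltn_ord l)) ?leq_addr.
  + by rewrite -[X in X == _]addn0 eqn_add2l ?orbF.
  + by rewrite eqn_add2l ?orbF.
- by rewrite cd' rkd pard eqxx p2 eqxx.
- by rewrite rkd pard eqxx orbT.
Qed.

Lemma subst_parP u : 0 < subst_rk u ->
  e' u (subst_par u) /\ subst_rk (subst_par u) < subst_rk u.
Proof.
case: u => [x|m]; last first.
  move=> _; split; first by rewrite /= map_f //; case: (gparP (ltn_ord m)).
  rewrite /=; case: (gp_case m) => [[k -> /andP[km /eqP ks]]|[-> ms]|[-> ms]].
  - by rewrite dec_inner /= ks ltn_add2l ltnS.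
  - have -> : dec n = inl a by rewrite -(dec_outer 0) addn0.
    by rewrite /= ms addnS ltnS leq_addr.
  - by rewrite dec_outer /= [m < _]ltnNge ms /= addnS ltnS leq_addr.
rewrite srk_inl => x0; have [ex ltx] := rh_par rh x0.
split; first exact: subst_reroute.
rewrite /=; case: (boolP (special a b c d x (par x))) => [|sp]; last first.
  by rewrite /rr reroute_plain //= ltn_mul2l.
have lt_mul p q (m : 'I_n) : p < q -> n.+1 * p + m.+1 < n.+1 * q.
  move=> pq; apply: leq_trans (_ : n.+1 * p.+1 <= _); last by rewrite leq_mul2l.
  by rewrite mulnSr ltn_add2l ltnS.
case/specialP=> i i4 [xi px]; rewrite xi in px ltx x0 *; rewrite px.
rewrite /rr reroute_special // (decode_port a b c d MG i4) /=.
move: i4 px x0 ltx; case: i {xi} => [|[|[|[|i]]]] //= i4; rewrite /outer /mate /= => px x0 ltx.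
- by move: para; rewrite x0 px eqxx.
- move: parb; rewrite x0 px eqxx /= => /esym np; case/and4P: MT => _ _ _ /and4P[_ _ _].
  rewrite np => ->; rewrite -px; exact: (lt_mul _ _ (Ordinal (port_ltn MG i4))).
- by move: ltx ltcd; rewrite px => /ltn_trans H /H; rewrite ltnn.
(* The case of the child d: its new parent has a rank based on a or on c, and both have smaller rank
   than d. *)
- apply: (lt_mul _ _ (Ordinal (port_ltn MG i4))); case: ifP => // ps.
  by apply: rkad; apply: leq_ltn_trans ps.
Qed.

Lemma subst_tree_sub : subrel T' e'.
Proof.
move=> u v /orP[] /andP[r0 /eqP<-]; first by case: (subst_parP r0).
by rewrite /e' (subst_sym MG symE abcd eab ecd); case: (subst_parP r0).
Qed.

Lemma subst_tree_degL x : deg T' (inl x) = deg T x.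
Proof.
transitivity #|[set v | e' (inl x) v & T' (inl x) v]|.
  apply: eq_card => v; rewrite !inE; apply/idP/andP => [tv|[]//].
  by split=> //; apply: subst_tree_sub.
rewrite subst_rowL //; apply: eq_card => y; rewrite !inE.
apply/andP/idP => [[xy]|txy]; first by rewrite subst_treeL.
have xy := parent_rel_sub symE rh txy.
by rewrite subst_treeL.
Qed.

Lemma subst_tree_degR (m : 'I_n) :
  deg T' (inr m) = if nat_of_ord m \in gpath M ++ flatten (gcycles M) then 1 else 3.
Proof.
transitivity #|[set v | e' (inr m) v & T' (inr m) v]|.
  apply: eq_card => v; rewrite !inE; apply/idP/andP => [tv|[]//].
  by split=> //; apply: subst_tree_sub.
rewrite subst_rowR //; case/and5P: MT => _ _ _ /allP/(_ m) + _.
rewrite mem_iota ltn_ord => /(_ isT)/eqP <-.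
by apply: eq_in_count => k kadj; apply: subst_treeR.
Qed.

Lemma subst_rooted_hist cs' :
  (forall x, (inl x \in flatten cs') = (x \in flatten cs)) ->
  (forall m : 'I_n, (inr m \in flatten cs') =
     (nat_of_ord m \in gpath M ++ flatten (gcycles M))) ->
  uniq (flatten cs') ->
  (forall C, C \in cs' -> cycle (cotree e' T') C /\ 2 < size C) ->
  rooted_hist e' subst_par subst_rk cs'.
Proof.
move=> csL csR ucs ccs; split=> //; last 1 first.
- move=> [x|m]; last by rewrite subst_tree_degR csR.
  by rewrite subst_tree_degL (rh_deg rh) csL.
- move=> [x|m] [y|k] /eqP; rewrite /= ?addnS // muln_eq0 /= => /eqP x0 /eqP.
  by rewrite ?addnS // muln_eq0 /= => /eqP y0; rewrite (rh_root rh x0 y0).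
- exact: subst_parP.
Qed.

Lemma subst_cotreeL x y : cotree e T x y -> ~~ special a b c d x y ->
  cotree e' T' (inl x) (inl y).
Proof.
case/andP=> xy txy sp; rewrite /cotree /e' substLL // xy sp /=.
have <- : rr x y = inl y by exact: reroute_plain.
by rewrite subst_treeL.
Qed.

Lemma subst_cotreeR j k : gadget_cotree M j k -> cotree e' T' (dec j) (dec k).
Proof.
have inner (m : 'I_n) l : gadget_cotree M m l -> cotree e' T' (dec m) (dec l).
  case/andP=> ladj tl; rewrite /cotree dec_inner subst_treeR // tl andbT.
  by rewrite /e' /= map_f.
move=> jk; case/andP: (jk) => kadj tjk; have kadj' := kadj.
rewrite (nbsC adjP) in kadj'.
case: (decode_case a b c d (nbs_ltn4 MG kadj')) => [[m Em _]|[i [i4 Ei] _]].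
  by rewrite Em in jk *; exact: inner.
have kE : k = Ordinal (port_ltn MG i4).
  by move: kadj; rewrite Ei (nbs_outer MG) // inE => /eqP.
rewrite (cotree_sym _ _ (subst_sym MG symE abcd eab ecd)) kE; apply: inner.
by rewrite /gadget_cotree -kE kadj' gadget_treeC.
Qed.

Lemma inner_cycles C : C \in gcycles M ->
  cycle (cotree e' T') (map dec C) /\ 2 < size (map dec C).
Proof.
move=> CM; case/and5P: MT => _ _ _ _ /and3P[_ /allP/(_ _ CM)/andP[cyc C3] _].
by rewrite size_map; split=> //; apply: homo_cycle cyc; exact: subst_cotreeR.
Qed.

Let cov := gpath M ++ flatten (gcycles M).

Let cov_ltn k : k \in cov -> k < n.
Proof. by case/and5P: MT => _ _ _ _ /and3P[/andP[_ /allP H] _ _] /H. Qed.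

Let cov_uniq : uniq cov.
Proof. by case/and5P: MT => _ _ _ _ /and3P[/andP[]]. Qed.

Let mem_decL x s : {subset s <= cov} -> (inl x \in map dec s) = false.
Proof.
move=> sc; apply/negP => /mapP[k /sc/cov_ltn kn].
by rewrite -[k]/(nat_of_ord (Ordinal kn)) dec_inner.
Qed.

Let mem_decR (m : 'I_n) s : {subset s <= cov} -> (inr m \in map dec s) = (nat_of_ord m \in s).
Proof.
move=> sc; apply/mapP/idP => [[k ks]|ms]; last by exists (nat_of_ord m); rewrite ?dec_inner.
have kn := cov_ltn (sc _ ks).
by rewrite -[k]/(nat_of_ord (Ordinal kn)) dec_inner => -[->].
Qed.

Let mem_inlL x (s : seq V) : ((inl x : W) \in map inl s) = (x \in s).
Proof. by apply: mem_map => ? ? []. Qed.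

Let mem_inlR m (s : seq V) : ((inr m : W) \in map inl s) = false.
Proof. by apply/negP => /mapP[]. Qed.

Let uniq_dec : uniq (map dec cov).
Proof.
rewrite map_inj_in_uniq ?cov_uniq // => k l /cov_ltn kn /cov_ltn ln.
by apply: decode_inj; rewrite // (leq_trans kn, leq_trans ln) // leq_addr.
Qed.

Let cotree_special x y : cotree e T x y -> special a b c d x y ->
  ~~ nilp (gpath M) /\ ((x, y) = (a, b) \/ (x, y) = (b, a)).
Proof.
case/andP=> _ txy; have Tcd : T c d by rewrite /parent_rel rkd pard eqxx orbT.
have Tab : T a b = nilp (gpath M) by rewrite /parent_rel para.
rewrite /special !inE => /or4P[] /eqP E; case: E txy => -> ->.
- by rewrite Tab; auto.
- by rewrite parent_relC Tab; auto.
- by rewrite Tcd.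
- by rewrite parent_relC Tcd.
Qed.

Lemma attach_realizable : essential_snark e -> 8 <= #|V| -> nilp (gpath M) ->
  realizable (map size (gcycles M) ++ map size cs).
Proof.
move=> es V8 np; pose cs' := map (map dec) (gcycles M) ++ map (map inl) cs.
have covE : cov = flatten (gcycles M) by rewrite /cov (nilP np).
have flE : flatten cs' = map dec cov ++ map inl (flatten cs).
  by rewrite flatten_cat -!map_flatten covE.
exists W, e', subst_par, subst_rk, cs'; split.
- exact: subst_essential_snark.
- apply: subst_rooted_hist.
  + by move=> x; rewrite flE mem_cat mem_decL // mem_inlL.
  + by move=> m; rewrite flE mem_cat mem_decR // mem_inlR orbF.
  + rewrite flE cat_uniq uniq_dec map_inj_uniq ?(rh_uniq rh) ?andbT /=; last by move=> ? ? [].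
    by apply/hasPn => _ /mapP[x _ ->]; rewrite /= mem_decL.
  + move=> C; rewrite mem_cat => /orP[] /mapP[C0 C0in ->]; first exact: inner_cycles.
    case: (rh_cycle rh C0in) => cyc C3; rewrite size_map; split=> //.
    apply: homo_cycle cyc => x y xy; apply: subst_cotreeL => //.
    by apply/negP => /(cotree_special xy)[]; rewrite np.
- by rewrite map_cat -!map_comp !(eq_map (fun c => size_map _ c)).
- by rewrite card_sum (leq_trans V8) ?leq_addr.
Qed.

(** The cycle is written from b to a, so that ab is its closing edge; appending [gpath] replaces
    this edge by the detour through the gadget. *)
Lemma extend_realizable p cs0 : essential_snark e -> 8 <= #|V| -> ~~ nilp (gpath M) ->
  cs = (b :: p) :: cs0 -> last b p = a ->
  realizable ((size (b :: p) + size (gpath M)) :: map size (gcycles M) ++ map size cs0).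
Proof.
move=> es V8 np csE lastp.
pose C1 := map inl (b :: p) ++ map dec (gpath M).
pose cs' := C1 :: map (map dec) (gcycles M) ++ map (map inl) cs0.
have perm4 (s1 s2 s3 s4 : seq W) :
    perm_eq ((s1 ++ s2) ++ (s3 ++ s4)) ((s2 ++ s3) ++ (s1 ++ s4)).
  by rewrite -!catA perm_catCA perm_cat2l perm_catCA.
have flE : perm_eq (flatten cs') (map dec cov ++ map inl (flatten cs)).
  have -> : flatten cs' = (map inl (b :: p) ++ map dec (gpath M)) ++
      (map dec (flatten (gcycles M)) ++ map inl (flatten cs0)).
    by rewrite /= flatten_cat -!map_flatten.
  have -> : map dec cov ++ map inl (flatten cs) =
      (map dec (gpath M) ++ map dec (flatten (gcycles M))) ++
      (map inl (b :: p) ++ map inl (flatten cs0)).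
    by rewrite csE /cov !map_cat.
  exact: perm4.
have bp_in : b :: p \in cs by rewrite csE mem_head.
have [cyc1 size1] := rh_cycle rh bp_in.
have ubp : uniq (b :: p).
  by move: (rh_uniq rh); rewrite csE [flatten _]/= -cat_cons cat_uniq => /and3P[].
have ab : a != b by move: abcd; rewrite /= !inE negb_or => /andP[/andP[]].
exists W, e', subst_par, subst_rk, cs'; split.
- exact: subst_essential_snark.
- apply: subst_rooted_hist.
  + by move=> x; rewrite (perm_mem flE) mem_cat mem_decL // mem_inlL.
  + by move=> m; rewrite (perm_mem flE) mem_cat mem_decR // mem_inlR orbF.
  + rewrite (perm_uniq flE) cat_uniq uniq_dec map_inj_uniq ?(rh_uniq rh) ?andbT /=; last by move=> ? ? [].
    by apply/hasPn => _ /mapP[x _ ->]; rewrite /= mem_decL.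
  + have notin C0 x : C0 \in cs0 -> x \in b :: p -> x \notin C0.
      move=> C0in xb; apply/negP => xC; move: (rh_uniq rh); rewrite csE [flatten _]/= -cat_cons cat_uniq.
      case/and3P=> _ /hasP[]; exists x => //.
      by apply/flattenP; exists C0.
    move=> C; rewrite inE mem_cat => /or3P[/eqP->|/mapP[C0 C0in ->]|/mapP[C0 C0in ->]].
    * split; last by rewrite size_cat !size_map (leq_trans size1) ?leq_addr.
      rewrite /C1 /= rcons_cat cat_path last_map lastp; apply/andP; split.
        case: p lastp ubp size1 cyc1 {csE perm4 flE bp_in notin cs' C1} => //= y p lastp.
        case/and3P=> bp yp up size1 /andP[by_ py].
        apply/andP; split.
          (* If the first edge were ab as well, the cycle would have length 2. *)
          apply: subst_cotreeL => //; apply/negP => /(cotree_special by_)[_ [[E1 E2]|[E2]]].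
            by rewrite E1 eqxx in ab.
          move: size1 lastp yp; rewrite E2; case: (p) => //= z p' _ <-.
          by rewrite mem_last.
        have {}py : path (cotree e T) y p by move: py; rewrite rcons_path => /andP[].
        (* The remaining edges avoid b, hence differ from ab. *)
        apply: (homo_path_in (P := predC1 b) _ _ py).
          move=> x z xb zb xz; apply: subst_cotreeL => //.
          apply/negP => /(cotree_special xz)[_ [[E1 E2]|[E1 E2]]].
            by rewrite E2 !inE eqxx in zb.
          by rewrite E1 !inE eqxx in xb.
        by apply/allP => x xp; rewrite !inE; apply: contraNneq bp => <-.
      have -> : inl a = dec n by rewrite -(dec_outer 0) addn0.
      have -> : inl b = dec (n + 1) by rewrite dec_outer.
      rewrite -map_rcons; apply: (homo_path subst_cotreeR).
      case/and5P: MT => _ _ _ _ /and3P[_ _].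
      by rewrite (negbTE np) => /andP[].
    * exact: inner_cycles.
    * have C0cs : C0 \in cs by rewrite csE inE C0in orbT.
      case: (rh_cycle rh C0cs) => cyc C3; rewrite size_map; split=> //.
      apply: (homo_cycle_in (P := [in C0]) _ _ cyc); last by apply/allP.
      move=> x y xC yC xy; apply: subst_cotreeL => //.
      apply/negP => /(cotree_special xy)[_ [[E1 E2]|[E1 E2]]].
        by have := notin _ b C0in (mem_head _ _); rewrite -E2 yC.
      by have := notin _ b C0in (mem_head _ _); rewrite -E1 xC.
- by rewrite /= map_cat -!map_comp !(eq_map (fun c => size_map _ c)) size_cat /= !size_map.
- by rewrite card_sum (leq_trans V8) ?leq_addr.
Qed.

End SubstTree.

(** * Realizing the multisets *)

Lemma rooted_hist_perm (V : finType) (e : rel V) par rk cs cs' :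
  perm_eq cs cs' -> rooted_hist e par rk cs -> rooted_hist e par rk cs'.
Proof.
move=> pcs [root parP degP ucs cyc]; split=> //.
- by move=> x; rewrite degP (perm_mem (perm_flatten pcs)).
- by rewrite -(perm_uniq (perm_flatten pcs)).
- by move=> c; rewrite -(perm_mem pcs); apply: cyc.
Qed.

Lemma exists_outside (V : finType) (s : seq V) (A B : {set V}) :
  size s + #|A| + #|B| < #|V| -> exists x, [/\ x \notin s, x \notin A & x \notin B].
Proof.
move=> lt; have : ~: ([set x in s] :|: A :|: B) != set0.
  rewrite -card_gt0 cardsCs setCK subn_gt0; apply: leq_ltn_trans lt.
  apply: leq_trans (leq_card_setU _ _) _; rewrite leq_add2r.
  apply: leq_trans (leq_card_setU _ _) _; rewrite leq_add2r.
  by rewrite cardsE card_size.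
by case/set0Pn => x; rewrite !inE !negb_or -andbA => /and3P[]; exists x.
Qed.

Section Modes.
Variables (V : finType) (e : rel V) (M : gadget) (par : V -> V) (rk : V -> nat).
Variable cs : seq (seq V).
Hypothesis MG : gadget_graph_ok M.
Hypothesis MT : gadget_hist_ok M.
Hypothesis es : essential_snark e.
Hypothesis rh : rooted_hist e par rk cs.
Hypothesis V8 : 8 <= #|V|.
Notation T := (parent_rel par rk).

Let symE : symmetric e := es_sym es.

Lemma exists_root : exists r, rk r = 0.
Proof.
have /card_gt0P[x _] : 0 < #|V| by apply: leq_trans V8.
elim/ltn_ind: {x}(rk x) {-2}x (erefl (rk x)) => k IHk x xk.
case: (posnP (rk x)) => [x0|x0]; first by exists x.
by have [_ lt] := rh_par rh x0; apply: (IHk (rk (par x))); rewrite // -xk.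
Qed.

Let tree_par d : 0 < rk d -> [/\ T (par d) d, T d (par d) & par d != d].
Proof.
move=> d0; rewrite /parent_rel d0 eqxx orbT; split=> //.
have [_] := rh_par rh d0.
by apply: contraTneq => ->; rewrite ltnn.
Qed.

(** Let a be the root, so that it has smaller rank than any d, and b one of its children. If d is
    neither the root nor a tree neighbour of a or b, then its parent is distinct from both; this
    excludes at most 1 + 3 + 3 choices. *)
Lemma attach_cycles : nilp (gpath M) -> realizable (map size (gcycles M) ++ map size cs).
Proof.
move=> np; have [r r0] := exists_root.
have degT x : deg T x <= 3 by rewrite (rh_deg rh); case: ifP.
have [b rb] : exists b, T r b.
  have : 0 < deg T r by rewrite (rh_deg rh); case: ifP.
  by rewrite /deg card_gt0 => /set0Pn[b]; rewrite inE; exists b.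
have [b0 pb] : 0 < rk b /\ par b = r.
  by move: rb; rewrite /parent_rel r0 /= => /andP[b0 /eqP].
have [d []] := exists_outside (s := [:: r]) (A := [set y | T r y]) (B := [set y | T b y])
    (leq_ltn_trans (leq_add (leq_add (leqnn 1) (degT r)) (degT b)) V8).
rewrite !inE => dr rd bd.
have d0 : 0 < rk d by rewrite lt0n; apply: contra dr => /eqP d0; apply/eqP/(rh_root rh).
have [Tcd _ cd] := tree_par d0.
have abcd : uniq [:: r; b; par d; d].
  rewrite /= !inE !negb_or (eq_sym r d) dr !andbT /=.
  have -> : r != b by apply: contraTneq b0 => <-; rewrite r0.
  have -> : r != par d by apply: contraNneq rd => ->.
  have -> : b != par d by apply: contraNneq bd => ->.
  by have -> : b != d by apply: contraNneq rd => <-.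
apply: (attach_realizable MG MT symE abcd _ rh d0) => //.
- exact: parent_rel_sub symE rh _ _ rb.
- by rewrite b0 pb eqxx np.
- by rewrite r0.
- by rewrite r0.
Qed.

(** Here a and b are consecutive leaves with one tree neighbour each, so together with the root at
    most five choices of d are excluded. *)
Lemma extend_cycle c cs0 : cs = c :: cs0 -> ~~ nilp (gpath M) ->
  realizable ((size c + size (gpath M)) :: map size (gcycles M) ++ map size cs0).
Proof.
move=> csE np; have cin : c \in cs by rewrite csE mem_head.
have [cyc c3] := rh_cycle rh cin.
case: c csE cin cyc c3 => // b p csE cin cyc c3; set a := last b p.
have deg1 x : x \in b :: p -> deg T x = 1.
  move=> xc; rewrite (rh_deg rh); suff -> : x \in flatten cs by [].
  by apply/flattenP; exists (b :: p).
have [r r0] := exists_root.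
have ap : a \in b :: p by exact: mem_last.
have lt8 : size [:: r; a; b] + #|[set y | T a y]| + #|[set y | T b y]| < #|V|.
  by rewrite -!/(deg T _) !deg1 ?mem_head // (leq_trans _ V8).
have [d []] := exists_outside lt8; rewrite !inE => /norP[dr /norP[da db]] ad bd.
have d0 : 0 < rk d by rewrite lt0n; apply: contra dr => /eqP d0; apply/eqP/(rh_root rh).
have [Tcd _ cd] := tree_par d0.
have Cab : cotree e T a b by move: cyc; rewrite /= rcons_path => /andP[].
have [eab Tab] := andP Cab.
have abcd : uniq [:: a; b; par d; d].
  rewrite /= !inE !negb_or (eq_sym a d) da (eq_sym b d) db cd !andbT /=.
  have -> : a != b by apply: contraTneq eab => ->; case: (es_short es) => ->.
  have -> : a != par d by apply: contraNneq ad => ->.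
  by have -> : b != par d by apply: contraNneq bd => ->.
move: Tab; rewrite /parent_rel negb_or => /andP[/negbTE para /negbTE parb].
apply: (extend_realizable MG MT symE abcd eab rh d0 erefl _ para _ es V8 np csE) => //.
- by rewrite parb (negbTE np).
- case/and5P: MT => _ _ _ _ /and3P[_ _]; rewrite (negbTE np) => /andP[/eqP-> _] //.
Qed.

End Modes.

Lemma realizable_attach M S : gadget_graph_ok M && gadget_hist_ok M && nilp (gpath M) ->
  realizable S -> realizable (map size (gcycles M) ++ S).
Proof.
move=> /andP[/andP[MG MT] np] [V [e [par [rk [cs [es rh pS V8]]]]]].
apply: realizable_perm (attach_cycles MG MT es rh V8 np).
by rewrite perm_cat2l.
Qed.

Lemma realizable_extend M c S :
  gadget_graph_ok M && gadget_hist_ok M && ~~ nilp (gpath M) ->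
  realizable (c :: S) -> realizable (c + size (gpath M) :: map size (gcycles M) ++ S).
Proof.
move=> /andP[/andP[MG MT] np] [V [e [par [rk [cs [es rh pS V8]]]]]].
have : c \in map size cs by rewrite (perm_mem pS) mem_head.
case/mapP=> C Cin sC.
have pcs := perm_to_rem Cin; have rh' := rooted_hist_perm pcs rh.
have := extend_cycle MG MT es rh' V8 erefl np; rewrite -sC.
apply: realizable_perm; rewrite perm_cons perm_cat2l.
have := perm_map size pcs; rewrite /= -sC perm_sym => H.
by rewrite -(perm_cons c) (perm_trans H).
Qed.
(* [gadget_add4] is the Petersen graph minus two adjacent vertices, so that inserting
   it is a dot product; the others are built from copies of it. *)
Definition gadget_add4 := Gadget 8
  [:: [:: 1; 2; 10]; [:: 0; 6; 7]; [:: 0; 3; 4]; [:: 2; 7; 9]; [:: 2; 5; 6]; [:: 4; 7; 11]; [:: 1; 4; 8]; [:: 1; 3; 5]; [:: 6]; [:: 3]; [:: 0]; [:: 5]]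
  [:: 10; 0; 0; 2; 2; 4; 4; 5]
  0 [:: 6; 1; 7; 3] [::].
Definition gadget_cons5 := Gadget 10
  [:: [:: 1; 7; 10]; [:: 0; 2; 6]; [:: 1; 3; 5]; [:: 2; 4; 13]; [:: 3; 6; 8]; [:: 2; 8; 9]; [:: 1; 4; 9]; [:: 0; 8; 11]; [:: 4; 5; 7]; [:: 5; 6; 12]; [:: 0]; [:: 7]; [:: 9]; [:: 3]]
  [:: 10; 0; 1; 2; 3; 2; 1; 0; 7; 12]
  9 [::] [:: [:: 9; 6; 4; 8; 5]].
Definition gadget_cons6 := Gadget 12
  [:: [:: 1; 2; 12]; [:: 0; 3; 13]; [:: 0; 4; 5]; [:: 1; 6; 7]; [:: 2; 7; 10]; [:: 2; 6; 11]; [:: 3; 5; 10]; [:: 3; 4; 11]; [:: 9; 10; 14]; [:: 8; 11; 15]; [:: 4; 6; 8]; [:: 5; 7; 9]; [:: 0]; [:: 1]; [:: 8]; [:: 9]]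
  [:: 12; 0; 0; 1; 2; 2; 3; 3; 14; 8; 8; 9]
  8 [::] [:: [:: 10; 4; 7; 11; 5; 6]].
Definition gadget_cons8 := Gadget 16
  [:: [:: 1; 2; 16]; [:: 0; 7; 14]; [:: 0; 3; 4]; [:: 2; 5; 6]; [:: 2; 7; 9]; [:: 3; 7; 8]; [:: 3; 9; 10]; [:: 1; 4; 5]; [:: 5; 9; 13]; [:: 4; 6; 8]; [:: 6; 11; 19]; [:: 10; 12; 13]; [:: 11; 14; 17]; [:: 8; 11; 15]; [:: 1; 12; 15]; [:: 13; 14; 18]; [:: 0]; [:: 12]; [:: 15]; [:: 10]]
  [:: 16; 0; 0; 2; 2; 3; 3; 5; 5; 6; 6; 10; 11; 11; 12; 18]
  15 [::] [:: [:: 15; 13; 8; 9; 4; 7; 1; 14]].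
Definition gadget_add2_7 := Gadget 18
  [:: [:: 1; 10; 20]; [:: 0; 2; 3]; [:: 1; 6; 9]; [:: 1; 4; 7]; [:: 3; 5; 6]; [:: 4; 9; 14]; [:: 2; 4; 17]; [:: 3; 8; 9]; [:: 7; 13; 19]; [:: 2; 5; 7]; [:: 0; 11; 17]; [:: 10; 12; 15]; [:: 11; 13; 14]; [:: 8; 12; 18]; [:: 5; 12; 16]; [:: 11; 16; 21]; [:: 14; 15; 17]; [:: 6; 10; 16]; [:: 13]; [:: 8]; [:: 0]; [:: 15]]
  [:: 20; 0; 1; 1; 3; 4; 4; 3; 7; 7; 0; 10; 11; 12; 12; 11; 15; 10]
  0 [:: 13; 8] [:: [:: 14; 16; 17; 6; 2; 9; 5]].

Lemma realizable_add4 c S : realizable (c :: S) -> realizable (c + 4 :: S).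
Proof. by apply: (@realizable_extend gadget_add4); vm_compute. Qed.

Lemma realizable_add2_7 c S : realizable (c :: S) -> realizable [:: c + 2, 7 & S].
Proof. by apply: (@realizable_extend gadget_add2_7); vm_compute. Qed.

Lemma realizable_cons5 S : realizable S -> realizable (5 :: S).
Proof. by apply: (@realizable_attach gadget_cons5); vm_compute. Qed.

Lemma realizable_cons6 S : realizable S -> realizable (6 :: S).
Proof. by apply: (@realizable_attach gadget_cons6); vm_compute. Qed.

Lemma realizable_cons8 S : realizable S -> realizable (8 :: S).
Proof. by apply: (@realizable_attach gadget_cons8); vm_compute. Qed.

Lemma realizable_swap2 c d : realizable [:: c; d] -> realizable [:: d; c].
Proof. by apply: realizable_perm; apply: permEl; exact: (perm_catC [:: c] [:: d]). Qed.

Definition reduced (S : seq nat) : bool := all (fun c => 5 <= c <= 8) S.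

(** Among single lengths below 10 only 6 is available, and from it the gadgets produce just the
    pairs of 6 with 5, 6, 8 and the pair of 8 with 7. The other six pairs are explicit graphs. *)
Lemma realizable_reduced2 c d : reduced [:: c; d] -> realizable [:: c; d].
Proof.
rewrite /reduced /= andbT => /andP[cP dP].
have [c5|[c6|[c7|c8]]] : c = 5 \/ c = 6 \/ c = 7 \/ c = 8 by lia.
all: have [d5|[d6|[d7|d8]]] : d = 5 \/ d = 6 \/ d = 7 \/ d = 8 by lia.
all: subst c d; clear.
all: do ?[exact: realizable_5_5 | exact: realizable_5_7 | exact: realizable_5_8
  | exact: realizable_6_7 | exact: realizable_7_7 | exact: realizable_8_8
  | exact: realizable_cons5 realizable_6 | exact: realizable_cons6 realizable_6
  | exact: realizable_cons8 realizable_6 | exact: (realizable_add2_7 realizable_6)].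
all: apply: realizable_swap2.
all: do ?[exact: realizable_5_7 | exact: realizable_5_8 | exact: realizable_6_7
  | exact: realizable_cons5 realizable_6 | exact: realizable_cons8 realizable_6
  | exact: (realizable_add2_7 realizable_6)].
Qed.

Lemma realizable_reduced S : 2 <= size S -> reduced S -> realizable S.
Proof.
elim/ltn_ind: {S}(size S) {-2}S (erefl (size S)) => k IHk S Sk; rewrite Sk => k2 redS.
case: (ltngtP k 2) => [|k3|k2']; [lia | | ]; last first.
  by move: Sk redS; rewrite k2'; case: S => [|c [|d []]] // _; apply: realizable_reduced2.
have remove c : c \in S -> (forall S', realizable S' -> realizable (c :: S')) ->
    realizable S.
  move=> cS consc; have pS := perm_to_rem cS.
  apply: (realizable_perm (S1 := c :: rem c S)); first by rewrite perm_sym.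
  have sz : size (rem c S) = k.-1 by rewrite size_rem // Sk.
  apply: consc; apply: (IHk k.-1) => //; [lia | by rewrite sz; lia |].
  by apply/allP => x /mem_rem; apply: (allP redS).
case: (boolP (5 \in S)) => [/remove|S5]; first by apply; exact: realizable_cons5.
case: (boolP (6 \in S)) => [/remove|S6]; first by apply; exact: realizable_cons6.
case: (boolP (8 \in S)) => [/remove|S8]; first by apply; exact: realizable_cons8.
have -> : S = [:: 5 + 2, 7 & nseq (k - 2) 7].
  have : all (pred1 7) S.
    apply/allP => x xS; have /andP[x5 x8] := allP redS _ xS.
    have : x != 5 by apply: contraNneq S5 => <-.
    have : x != 6 by apply: contraNneq S6 => <-.
    have : x != 8 by apply: contraNneq S8 => <-.
    by move=> /= n8 n6 n5; apply/eqP; clear -x5 x8 n8 n6 n5; lia.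
  move/all_pred1P; rewrite Sk => ->.
  by clear -k3; case: k k3 => [|[|j]] // _; rewrite subn2.
apply: realizable_add2_7; apply: (IHk k.-1); first by clear -k3; lia.
- by rewrite /= size_nseq; clear -k3; lia.
- by rewrite /= size_nseq; clear -k3; lia.
- by rewrite /reduced /= all_nseq orbT.
Qed.

Lemma realizable_add4n c j S : realizable (c :: S) -> realizable (c + 4 * j :: S).
Proof.
move=> rS; elim: j => [|j IHj]; first by rewrite muln0 addn0.
by rewrite mulnS [4 + _]addnC addnA; apply: realizable_add4.
Qed.

(** [R] holds entries already at their final length; generalizing over it lets the induction
    lengthen the head and move it there. The map picks the representative modulo 4 in 5..8. *)
Lemma realizable_lift S R : all (leq 5) S ->
  realizable (map (fun c => (c - 5) %% 4 + 5) S ++ R) -> realizable (S ++ R).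
Proof.
elim: S R => //= c S IHS R /andP[c5 S5] rS.
apply: (realizable_perm (S1 := S ++ c :: R)); first by rewrite -[c :: R]cat1s -[c :: S ++ R]cat1s perm_catCA.
apply: IHS => //; set S' := map _ S in rS *.
apply: (realizable_perm (S1 := c :: S' ++ R)).
  by rewrite -[c :: R]cat1s -[c :: S' ++ R]cat1s perm_catCA.
have -> : c = (c - 5) %% 4 + 5 + 4 * ((c - 5) %/ 4).
  by have := divn_eq (c - 5) 4; lia.
exact: realizable_add4n.
Qed.

Lemma realizable_all S : S != [::] -> all (leq 5) S ->
  (size S = 1 -> head 0 S = 6 \/ 10 <= head 0 S) -> realizable S.
Proof.
case: S => // c [|d S] _ S5 S1.
  have [/= ->|/= c10] := S1 erefl; first exact: realizable_6.
  (* One starting length for each residue modulo 4; 10 itself arises as 6 + 4. *)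
  have -> : c = 10 + (c - 10) %% 4 + 4 * ((c - 10) %/ 4).
    by have := divn_eq (c - 10) 4; lia.
  apply: realizable_add4n; have : (c - 10) %% 4 < 4 by rewrite ltn_mod.
  case: (_ %% 4) => [|[|[|[|]]]] // _.
  - exact: (realizable_add4 realizable_6).
  - exact: realizable_11.
  - exact: realizable_12.
  - exact: realizable_13.
rewrite -[_ :: _]cats0; apply: realizable_lift => //; rewrite cats0.
apply: realizable_reduced; first by rewrite size_map.
by apply/allP => _ /mapP[x _ ->]; have := ltn_pmod (x - 5) (isT : 0 < 4); lia.
Qed.

(** * Enumeration of leaf-labelled trees *)

(* A hist with a single outer cycle of length c is encoded by the binary tree left
   after deleting the leaf 0, its leaves being labelled by the other positions on
   the cycle. *)
Inductive tree := Leaf of nat | Node of tree & tree.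

Fixpoint leaf_seq (t : tree) : seq nat :=
  match t with Leaf i => [:: i] | Node t1 t2 => leaf_seq t1 ++ leaf_seq t2 end.

Fixpoint leaves_at (k : nat) (t : tree) : seq nat :=
  match t, k with
  | Leaf i, 0 => [:: i]
  | Node t1 t2, k'.+1 => leaves_at k' t1 ++ leaves_at k' t2
  | _, _ => [::]
  end.

(* The colours are 1, 2, 3; the value 0 records a conflict and is absorbing. *)
Definition third (a b : nat) : nat :=
  if [|| a == 0, b == 0 | a == b] then 0 else 6 - (a + b).

Fixpoint tree_colour (h : nat -> nat) (t : tree) : nat :=
  match t with
  | Leaf i => h i
  | Node t1 t2 => third (tree_colour h t1) (tree_colour h t2)
  end.

Definition near (c k i j : nat) : bool :=
  (j == (i + k) %% c) || (i == (j + k) %% c).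

(* Two subtrees hanging from a common vertex close no cycle of length 3 or 4 with
   edges of the outer cycle. *)
Definition far (c : nat) (t1 t2 : tree) : bool :=
  let apart k l m := all (fun i => all (fun j => ~~ near c m i j) (leaves_at l t2))
                         (leaves_at k t1) in
  [&& apart 0 0 1, apart 0 0 2, apart 0 1 1 & apart 1 0 1].

Fixpoint tree_ok (c : nat) (t : tree) : bool :=
  if t is Node t1 t2 then [&& tree_ok c t1, tree_ok c t2 & far c t1 t2] else true.

(** The deleted leaf 0 is itself a subtree at the top vertex. These are the conditions [far] between
    it and the two other subtrees, whose leaves are one level deeper when seen from the whole
    tree. *)
Definition root_ok (c : nat) (t : tree) : bool :=
  let apart k m := all (fun j => ~~ near c m 0 j) (leaves_at k t) in
  [&& apart 1 1, apart 1 2 & apart 2 1].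

Fixpoint splits (s : seq nat) : seq (seq nat * seq nat) :=
  if s is x :: s' then
    [seq (x :: p.1, p.2) | p <- splits s'] ++ [seq (p.1, x :: p.2) | p <- splits s']
  else [:: ([::], [::])].

(** [k] is fuel. The first label always goes to the left subtree, so that the two orders of the
    children are not both enumerated; testing [far] at every node prunes early. *)
Fixpoint trees (k c : nat) (A : seq nat) : seq tree :=
  if k is k'.+1 then
    match A with
    | [::] => [::]
    | [:: i] => [:: Leaf i]
    | m :: rest =>
      flatten [seq [seq t <- [seq Node t1 t2 | t1 <- trees k' c (m :: p.1), t2 <- trees k' c p.2]
                      | if t is Node t1 t2 then far c t1 t2 else false]
                | p <- splits rest & ~~ nilp p.2]
    end
  else [::].

(** A substitute for equality up to exchanging children that retains only what the tests read:
    colours and the labels at each depth. *)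
Definition tree_sim (t t' : tree) : Prop :=
  (forall h, tree_colour h t = tree_colour h t') /\
  (forall k, leaves_at k t =i leaves_at k t').

Lemma thirdC a b : third a b = third b a.
Proof. by rewrite /third orbCA (eq_sym a b) addnC. Qed.

Lemma nearC c k i j : near c k i j = near c k j i.
Proof. by rewrite /near orbC. Qed.

Lemma farC c t1 t2 : far c t1 t2 = far c t2 t1.
Proof.
have apartC k l m s1 s2 : all (fun i => all (fun j => ~~ near c m i j) (leaves_at l s2)) (leaves_at k s1) =
    all (fun i => all (fun j => ~~ near c m i j) (leaves_at k s1)) (leaves_at l s2).
  apply/idP/idP => /allP H; apply/allP => i ii; apply/allP => j jj; rewrite nearC;
    by have /allP := H _ jj; apply.
rewrite /far !(apartC _ _ _ t1 t2).
by congr [&& _, _ & _]; rewrite andbC.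
Qed.

Lemma far_sim c t1 t2 t1' t2' : tree_sim t1 t1' -> tree_sim t2 t2' ->
  far c t1 t2 = far c t1' t2'.
Proof.
move=> [_ s1] [_ s2]; rewrite /far.
have E k l m : all (fun i => all (fun j => ~~ near c m i j) (leaves_at l t2)) (leaves_at k t1) =
   all (fun i => all (fun j => ~~ near c m i j) (leaves_at l t2')) (leaves_at k t1').
  by rewrite (eq_all_r (s1 k)); apply: eq_all => i; rewrite (eq_all_r (s2 l)).
by rewrite !E.
Qed.

Lemma root_ok_sim c t t' : tree_sim t t' -> root_ok c t = root_ok c t'.
Proof. by move=> [_ s]; rewrite /root_ok !(eq_all_r (s _)). Qed.

Lemma splits_filter (p : pred nat) s : ([seq x <- s | p x], [seq x <- s | ~~ p x]) \in splits s.
Proof.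
elim: s => //= x s IHs; rewrite mem_cat; case: (p x) => /=; apply/orP; [left | right].
  by apply/mapP; exists ([seq x <- s | p x], [seq x <- s | ~~ p x]).
by apply/mapP; exists ([seq x <- s | p x], [seq x <- s | ~~ p x]).
Qed.

Lemma leaf_seq_neq0 t : leaf_seq t != [::].
Proof. by elim: t => //= t1; case: (leaf_seq t1). Qed.

Lemma all_flatten (T : Type) (p : pred T) ss : all p (flatten ss) = all (all p) ss.
Proof. by elim: ss => //= s ss IHss; rewrite all_cat IHss. Qed.

Lemma tree_sim_trans t1 t2 t3 : tree_sim t1 t2 -> tree_sim t2 t3 -> tree_sim t1 t3.
Proof.
move=> [c12 l12] [c23 l23]; split=> [h|k i]; first by rewrite c12 c23.
by rewrite l12 l23.
Qed.

Lemma tree_sim_swap t1 t2 : tree_sim (Node t1 t2) (Node t2 t1).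
Proof.
by split=> [h|[|k] i] //=; [rewrite thirdC | rewrite !mem_cat orbC].
Qed.

Lemma tree_sim_node t1 t2 t1' t2' : tree_sim t1 t1' -> tree_sim t2 t2' ->
  tree_sim (Node t1 t2) (Node t1' t2').
Proof.
move=> [c1 l1] [c2 l2]; split=> [h|[|k] i] //=; first by rewrite c1 c2.
by rewrite !mem_cat l1 l2.
Qed.

(* [tree] has no equality operator, whence the membership test in [all P] form. *)
Lemma trees_complete c t k A (P : pred tree) : tree_ok c t -> uniq (leaf_seq t) ->
  perm_eq (leaf_seq t) A -> size A <= k -> all P (trees k c A) ->
  exists2 t', tree_sim t t' & P t'.
Proof.
elim: t k A P => [i|t1 IH1 t2 IH2] k A P /=.
  move=> _ _ pA; have -> : A = [:: i].
    by apply/perm_small_eq; rewrite // perm_sym.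
  by case: k => //= k _ /andP[Pi _]; exists (Leaf i).
case/and3P=> ok1 ok2 far12; rewrite cat_uniq => /and3P[u1 dis u2] pA Ak allP_.
pose complete t := forall k A (P : pred tree), tree_ok c t -> uniq (leaf_seq t) ->
  perm_eq (leaf_seq t) A -> size A <= k -> all P (trees k c A) ->
  exists2 t', tree_sim t t' & P t'.
(* Since [far] and [tree_sim] tolerate exchanging the children, the first label of [A] may be
   assumed to lie in the left subtree, as in [trees]. *)
have main ta tb : complete ta -> complete tb -> tree_ok c ta -> tree_ok c tb ->
    far c ta tb -> uniq (leaf_seq ta) -> uniq (leaf_seq tb) ->
    ~~ has [in leaf_seq ta] (leaf_seq tb) ->
    perm_eq (leaf_seq ta ++ leaf_seq tb) A -> head 0 A \in leaf_seq ta ->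
    exists2 t', tree_sim (Node ta tb) t' & P t'.
  move=> {IH1 IH2 u1 dis u2 ok1 ok2 far12} IHa IHb oka okb farab ua ub /hasPn dis {pA}pA.
  have uA : uniq A.
    by rewrite -(perm_uniq pA) cat_uniq ua ub andbT; apply/hasPn.
  case: A pA uA Ak allP_ => [|m rest].
    by move/perm_size; rewrite size_cat /=; have := leaf_seq_neq0 ta; case: (leaf_seq ta).
  move=> pA /= /andP[mrest urest]; case: k => // k Ak.
  have memA x : (x \in leaf_seq ta) || (x \in leaf_seq tb) = (x \in m :: rest).
    by rewrite -(perm_mem pA) mem_cat.
  have [y yb] : exists y, y \in leaf_seq tb.
    by have := leaf_seq_neq0 tb; case: (leaf_seq tb) => // y s _; exists y; rewrite mem_head.
  move=> allP_ ma.
  have yrest : y \in rest.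
    have := memA y; rewrite yb orbT inE => /esym/orP[/eqP ym|//].
    by have := dis _ yb; rewrite ym /= ma.
  pose B := [seq x <- rest | x \in leaf_seq ta].
  pose C := [seq x <- rest | x \notin leaf_seq ta].
  have CN : ~~ nilp C.
    have : y \in C by rewrite mem_filter yrest andbT; exact: dis.
    by case: (C).
  have BC : size B + size C = size rest by rewrite !size_filter count_predC.
  have pB : perm_eq (leaf_seq ta) (m :: B).
    apply: uniq_perm => //; first by rewrite /= filter_uniq // mem_filter (negbTE mrest) andbF.
    move=> x; rewrite inE mem_filter; have := memA x; rewrite inE.
    case: (altP (x =P m)) => [->|_] /=; first by rewrite ma.
    by case: (x \in leaf_seq ta) => //= <-.
  have pC : perm_eq (leaf_seq tb) C.
    apply: uniq_perm; rewrite ?filter_uniq // => x; rewrite mem_filter.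
    have := memA x; rewrite inE; case: (boolP (x \in leaf_seq tb)) => [xb|xb].
      have xa : x \notin leaf_seq ta := dis _ xb.
      rewrite (negbTE xa) /= => /esym/orP[/eqP xm|-> //].
      by rewrite xm ma in xa.
    by rewrite orbF; case: (x \in leaf_seq ta) => //=; case: (x \in rest); rewrite ?orbT.
  have {}allP_ : all (fun t1 => all (fun t2 => far c t1 t2 ==> P (Node t1 t2))
      (trees k c C)) (trees k c (m :: B)).
    have : all P (flatten
      [seq [seq t <- [seq Node t1 t2 | t1 <- trees k c (m :: p.1), t2 <- trees k c p.2]
                      | if t is Node t1 t2 then far c t1 t2 else false]
                | p <- splits rest & ~~ nilp p.2]).
      by case: (rest) yrest allP_.
    rewrite all_flatten all_map => /allP /(_ (B, C)).
    rewrite mem_filter CN splits_filter => /(_ isT) /=.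
    rewrite all_filter all_flatten all_map; apply: sub_all => t /=.
    by rewrite all_map.
  case: (IHa _ _ _ oka ua pB _ allP_) => [|ta' sima].
    by move: Ak CN; rewrite /nilp -BC /=; clear; lia.
  move=> allP'; case: (IHb _ _ _ okb ub pC _ allP') => [|tb' simb].
    by move: Ak; rewrite -BC /=; clear; lia.
  rewrite -(far_sim c sima simb) farab /= => PN.
  by exists (Node ta' tb') => //; exact: tree_sim_node.
have : head 0 A \in leaf_seq t1 ++ leaf_seq t2.
  rewrite (perm_mem pA); case: (A) pA => [|m s]; last by rewrite mem_head.
  by move/perm_size; rewrite size_cat /=; have := leaf_seq_neq0 t1; case: (leaf_seq t1).
rewrite mem_cat => /orP[m1|m2]; first exact: (main t1 t2).
case: (main t2 t1) => //.
- by rewrite farC.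
- by rewrite has_sym.
- by rewrite perm_catC.
- by move=> t' sim Pt'; exists t' => //; apply: tree_sim_trans (tree_sim_swap _ _) sim.
Qed.

Fixpoint colour_words (k last : nat) : seq (seq nat) :=
  if k is k'.+1 then
    flatten [seq [seq a :: w | w <- colour_words k' a] | a <- iota 1 3 & a != last]
  else [:: [::]].

Definition cycle_colouring (c : nat) (x : seq nat) : bool :=
  all (fun i => (0 < nth 0 x i <= 3) && (nth 0 x i != nth 0 x ((i + 1) %% c))) (iota 0 c).

(** Entry [i] of [x] is the colour of the cycle edge from position [i] to the next; adding [c.-1]
    modulo [c] steps back by one. What remains is the colour of the tree edge at leaf [i]. *)
Definition leaf_colour (c : nat) (x : seq nat) (i : nat) : nat :=
  third (nth 0 x ((i + c.-1) %% c)) (nth 0 x i).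

(** The top edge of the tree ends in leaf 0, so the colour propagated to the top must be the one
    left over at position 0. *)
Definition all_trees_colourable (c : nat) : bool :=
  let cols := [seq [seq leaf_colour c x i | i <- iota 0 c]
                 | x <- colour_words c 0 & cycle_colouring c x] in
  all (fun t => if root_ok c t then
                  has (fun h => tree_colour (nth 0 h) t == nth 0 h 0) cols
                else true) (trees c.-1 c (iota 1 c.-1)).

Lemma tree_colour_ext h h' t : {in leaf_seq t, h =1 h'} -> tree_colour h t = tree_colour h' t.
Proof.
elim: t => [i|t1 IH1 t2 IH2] /= H; first by rewrite H ?mem_head.
by rewrite IH1 ?IH2 // => i it; apply: H; rewrite mem_cat it ?orbT.
Qed.

Lemma all_trees_colourableP c t : all_trees_colourable c -> 0 < c ->
  tree_ok c t -> root_ok c t -> perm_eq (leaf_seq t) (iota 1 c.-1) ->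
  exists2 x, cycle_colouring c x & tree_colour (leaf_colour c x) t = leaf_colour c x 0.
Proof.
move=> chk c0 okt okr pt.
have ut : uniq (leaf_seq t) by rewrite (perm_uniq pt) iota_uniq.
have [|t' sim] := trees_complete okt ut pt _ chk; first by rewrite size_iota.
rewrite -(root_ok_sim c sim) okr => /hasP[_ /mapP[x + ->]].
rewrite mem_filter => /andP[xP _] /eqP E; exists x => //.
have nthE i : i < c -> nth 0 [seq leaf_colour c x i | i <- iota 0 c] i = leaf_colour c x i.
  by move=> ic; rewrite (nth_map 0) ?size_iota // nth_iota.
rewrite -(nthE 0) // -E -(sim.1); apply: tree_colour_ext => i.
by rewrite (perm_mem pt) mem_iota => /andP[i1 ic]; rewrite nthE //; clear -i1 ic c0; lia.
Qed.

(** The length 6 is absent because the Petersen graph realizes it. *)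
Lemma all_trees_colourable_small : all (all_trees_colourable) [:: 5; 7; 8; 9].
Proof. by vm_compute. Qed.

(** * From a hist to a labelled tree *)

Lemma connect_invariant (V : finType) (R : rel V) (P : pred V) x y :
  connect R x y -> P x -> (forall a b, P a -> R a b -> P b) -> P y.
Proof.
case/connectP=> p; elim: p x => [|z p IHp] x /=; first by move=> _ ->.
by case/andP=> xz pz yE Px step; apply: (IHp z) => //; apply: step xz.
Qed.

(* Grow a path at its head until all neighbours of the head lie on it. *)
Lemma two_regular_cycle (V : finType) (C : rel V) x :
  symmetric C -> irreflexive C -> (forall y, connect C x y -> deg C y = 2) ->
  exists q, [/\ cycle C q, uniq q, 2 < size q & q =i connect C x].
Proof.
move=> symC irrC deg2.
have [q [cyc uq q3 xq]] : exists q, [/\ cycle C q, uniq q, 2 < size q &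
    exists2 y, y \in q & connect C x y].
  have : exists y t, [/\ path C y t, uniq (y :: t) & connect C x y].
    by exists x, [::]; split.
  case=> y [t [pt ut xy]].
  elim: {t}(#|V| - size t) {-2}t (leqnn (#|V| - size t)) y pt ut xy => [|k IHk] t tk y pt ut xy.
    have := max_card [in y :: t]; rewrite (card_uniqP ut) /=.
    by move: tk; rewrite leqn0 subn_eq0 leqNgt => /negP.
  case: (boolP [exists z, C y z && (z \notin y :: t)]) => [/existsP[z /andP[yz zt]]|].
    apply: (IHk (y :: t) _ z); last 1 first.
    - exact: connect_trans xy (connect1 yz).
    - by move: tk; rewrite /=; clear; lia.
    - by rewrite /= symC yz.
    - by rewrite /= in ut *; rewrite zt.
  rewrite negb_exists => /forallP nbr.
  have {}nbr z : C y z -> z \in t.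
    move=> yz; have := nbr z; rewrite yz /= negbK inE => /orP[/eqP zy|//].
    by rewrite zy irrC in yz.
  case: t tk pt ut nbr => [|w t] _ pt ut nbr.
    have := deg2 _ xy; rewrite /deg (_ : [set z | _] = set0) ?cards0 //.
    by apply/setP => z; rewrite !inE; apply/negP => /nbr.
  have [z [yz zw]] : exists z, C y z /\ z != w.
    have := deg2 _ xy; rewrite /deg (cardsD1 w) => D.
    have : 0 < #|[set z | C y z] :\ w| by move: D; case: (_ \in _) => /=; clear; lia.
    by rewrite card_gt0 => /set0Pn[z]; rewrite !inE => /andP[zw yz]; exists z.
  have := nbr z yz; rewrite inE (negbTE zw) /= => zt.
  case/splitPr: zt pt ut nbr => t1 t2 pt ut _.
  exists [:: y, w & rcons t1 z]; split.
  - move: pt; rewrite -cat_rcons -cat_cons cat_path => /andP[pt _].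
    change (path C y (rcons (w :: rcons t1 z) y)).
    by rewrite rcons_path pt last_cons last_rcons symC.
  - by move: ut; rewrite -cat_rcons -!cat_cons cat_uniq => /and3P[].
  - by rewrite /= size_rcons.
  - by exists y; rewrite ?mem_head.
case: xq => y yq xy; exists q; split=> // z.
have symc := sym_connect_sym symC.
rewrite [RHS](_ : _ = connect C y z); last exact: (same_connect symc xy).
apply/idP/idP => [zq|]; first exact: (connect_cycle cyc).
move/connect_invariant => /(_ [in q]) /=; apply=> // v w vq vw.
have cxv : connect C x v by apply: connect_trans xy _; apply: (connect_cycle cyc).
by case/orP: (cycle_closed_nbr symC cyc uq q3 vq (deg2 _ cxv) vw) => /eqP->;
  rewrite ?mem_next ?mem_prev.
Qed.

Lemma connect_uniq_path (V : finType) (R : rel V) x y :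
  connect R x y -> exists p, [/\ path R x p, uniq (x :: p) & y = last x p].
Proof. by case/connectP=> p Rp ->; case/shortenP: Rp => p' Rp' up' _; exists p'. Qed.

Section VertexTree.
Variable V : eqType.

Inductive vtree := VLeaf of V | VNode of V & vtree & vtree.

Definition top (t : vtree) : V := match t with VLeaf v | VNode v _ _ => v end.

Fixpoint nodes (t : vtree) : seq V :=
  match t with VLeaf v => [:: v] | VNode v t1 t2 => v :: nodes t1 ++ nodes t2 end.

Fixpoint positions (q : seq V) (t : vtree) : tree :=
  match t with
  | VLeaf v => Leaf (index v q)
  | VNode _ t1 t2 => Node (positions q t1) (positions q t2)
  end.

Lemma top_nodes t : top t \in nodes t.
Proof. by case: t => *; rewrite mem_head. Qed.

End VertexTree.

Fixpoint hanging (V : finType) (T : rel V) (w : V) (t : vtree V) : Prop :=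
  match t with
  | VLeaf v => T v w /\ deg T v = 1
  | VNode v t1 t2 =>
    [/\ T v w, deg T v = 3, uniq [:: w; top t1; top t2] & hanging T v t1 /\ hanging T v t2]
  end.

Section Forest.
Variables (V : finType) (T : rel V).
Hypothesis symT : symmetric T.
Hypothesis irrT : irreflexive T.
Hypothesis acyc : forall p, ~ is_cycle T p.
Hypothesis degT : forall x, (deg T x == 1) || (deg T x == 3).

Definition avoiding (w : V) : rel V := fun x y => [&& T x y, x != w & y != w].

(** For a tree edge vw, this is the subtree that hangs from w at v. *)
Definition branch (v w : V) : pred V := connect (avoiding w) v.

Lemma avoiding_path w x p : path (avoiding w) x p -> w \notin p.
Proof.
elim: p x => //= y p IHp x /andP[/and3P[_ _ yw] py].
by rewrite inE negb_or eq_sym yw (IHp y).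
Qed.

(** A path off [v] between two different neighbours of [v] would close a cycle through [v]. *)
Lemma acyclic_avoiding v v1 v2 :
  v1 != v -> v2 != v -> T v v1 -> T v v2 -> connect (avoiding v) v1 v2 -> v1 = v2.
Proof.
move=> n1 n2 E1 E2 /connect_uniq_path[p [pp up v2E]].
rewrite {}v2E in n2 E2 *.
case: p pp up n2 E2 => //= y p pp up n2 E2.
case: (acyc (p := [:: v, v1, y & p])); split=> //.
have {n2} avp : v \notin v1 :: y :: p.
  by rewrite inE negb_or eq_sym n1 (@avoiding_path v v1 (y :: p) pp).
apply/andP; split; last by rewrite /= in up avp *; rewrite avp.
change (path T v (rcons (v1 :: y :: p) v)).
rewrite rcons_path last_cons symT E2 andbT /= E1 /=.
by case/andP: pp => /and3P[-> _ _]; apply: sub_path => a b /and3P[].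
Qed.

Lemma branch_root v w : v \in branch v w.
Proof. exact: connect0. Qed.

Lemma branch_notin v w : v != w -> w \notin branch v w.
Proof.
move=> vw; apply/negP => wb.
have : predC1 w w by apply: (connect_invariant wb) => //= a b _ /and3P[].
by rewrite /= eqxx.
Qed.

Lemma branch_step v w x y : v != w -> x \in branch v w -> T x y -> y != w ->
  y \in branch v w.
Proof.
move=> vw xb xy yw; apply: connect_trans (xb : connect _ _ _) (connect1 _).
by rewrite /avoiding xy yw andbT /=; apply: contraNneq (branch_notin vw) => xw; rewrite -{1}xw.
Qed.

Lemma neqT x y : T x y -> x != y.
Proof. by apply: contraTneq => ->; rewrite irrT. Qed.

Lemma branch_sub v w v1 : T v w -> T v v1 -> v1 != w -> {subset branch v1 v <= branch v w}.
Proof.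
move=> vw vv1 v1w x xb.
have v1v : v1 != v by rewrite eq_sym neqT.
suff /andP[] : (x \in branch v w) && (x \in branch v1 v) by [].
apply: (connect_invariant (P := fun x => (x \in branch v w) && (x \in branch v1 v)) xb).
  by rewrite branch_root andbT (branch_step (x := v)) ?branch_root // neqT.
move=> a b /andP[aw a1] /and3P[ab av bv].
have b1 : b \in branch v1 v by exact: branch_step a1 ab bv.
rewrite b1 andbT; apply: branch_step aw ab _; first exact: neqT.
apply: contra v1w => /eqP bw; rewrite bw in b1; apply/eqP.
by apply: (acyclic_avoiding v1v _ vv1 vw b1); rewrite eq_sym neqT.
Qed.

Lemma branch_case v w x : T v w -> x \in branch v w ->
  x = v \/ exists v1, [/\ T v v1, v1 != w & x \in branch v1 v].
Proof.
move=> vw xb; have nvw := neqT vw.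
pose P x := (x == v) || [exists v1, [&& T v v1, v1 != w & x \in branch v1 v]].
suff : P x by case/orP=> [/eqP|/existsP[v1 /and3P[? ? ?]]]; [left | right; exists v1].
apply: (connect_invariant xb); first by rewrite /P eqxx.
move=> a b + /and3P[ab aw bw]; rewrite /P; case: (altP (b =P v)) => //= bv.
case/orP=> [/eqP av|/existsP[v1 /and3P[vv1 v1w ab1]]]; apply/existsP.
  by exists b; rewrite -av ab bw branch_root.
exists v1; rewrite vv1 v1w; apply: branch_step ab1 ab bv.
by rewrite eq_sym neqT.
Qed.

(** Induction on the size of the branch: the branch of a child is contained in it and misses [v].
    Acyclicity makes the branches of the two children disjoint. *)
Lemma exists_hanging v w : T v w ->
  exists t, [/\ top t = v, hanging T w t, uniq (nodes t) & nodes t =i branch v w].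
Proof.
elim/ltn_ind: {v w}#|branch v w| {-2}v {-2}w (erefl #|branch v w|) => k IHk v w bk vw.
have nvw := neqT vw.
case/orP: (degT v) => /eqP dv.
  exists (VLeaf v); split=> //= x; rewrite inE; apply/eqP/idP => [->|].
    exact: branch_root.
  case/(branch_case vw) => [//|[v1 [vv1 v1w _]]].
  move/eqP: dv => /cards1P[u /setP E].
  have := E v1; have := E w; rewrite !inE vw vv1 => /esym/eqP wu /esym/eqP v1u.
  by rewrite v1u wu eqxx in v1w.
have [v1 [v2 [vv1 vv2 wv12 nbr]]] : exists v1 v2, [/\ T v v1, T v v2, uniq [:: w; v1; v2] &
    forall x, T v x -> x \in [:: w; v1; v2]].
  have wN : w \in [set y | T v y] by rewrite inE.
  have : #|[set y | T v y] :\ w| == 2.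
    by move: dv; rewrite /deg (cardsD1 w) wN; clear; lia.
  case/cards2P=> v1 [v2 [v12 /setP E]].
  have Ex x : (x != w) && T v x = (x == v1) || (x == v2) by have := E x; rewrite !inE.
  have /andP[v1w vv1] : (v1 != w) && T v v1 by rewrite Ex eqxx.
  have /andP[v2w vv2] : (v2 != w) && T v v2 by rewrite Ex eqxx orbT.
  exists v1, v2; split=> //.
    by rewrite /= !inE negb_or v12 eq_sym v1w eq_sym v2w.
  by move=> x vx; rewrite !inE -Ex vx andbT; case: (x == w).
have [v1w v2w v12] : [/\ v1 != w, v2 != w & v1 != v2].
  by move: wv12; rewrite /= !inE negb_or andbT => /andP[/andP[]]; rewrite eq_sym => -> ; rewrite eq_sym.
have small u : T v u -> u != w -> #|branch u v| < k.
  move=> vu uw; rewrite -bk; apply: proper_card; apply/properP; split.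
    by apply/subsetP => x; apply: branch_sub.
  by exists v; rewrite ?branch_root // branch_notin // eq_sym neqT.
have T1 : T v1 v by rewrite symT.
have T2 : T v2 v by rewrite symT.
have [t1 [top1 h1 u1 n1]] := IHk _ (small _ vv1 v1w) _ _ erefl T1.
have [t2 [top2 h2 u2 n2]] := IHk _ (small _ vv2 v2w) _ _ erefl T2.
exists (VNode v t1 t2); split=> //=.
- by split=> //; rewrite top1 top2.
- rewrite mem_cat n1 n2 cat_uniq u1 u2 !negb_or !branch_notin ?(eq_sym v1) ?(eq_sym v2) ?neqT //=.
  rewrite andbT; apply/hasPn => x; rewrite n2 => x2 /=; rewrite n1; apply/negP => x1.
  have symc := sym_connect_sym (e := avoiding v).
  have sa : symmetric (avoiding v) by move=> a b; rewrite /avoiding symT [(a != v) && _]andbC.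
  have c12 : connect (avoiding v) v1 v2.
    by apply: connect_trans x1 _; rewrite (sym_connect_sym sa).
  by move/eqP: v12; apply; apply: (acyclic_avoiding _ _ vv1 vv2 c12); rewrite eq_sym neqT.
- move=> x; rewrite inE mem_cat n1 n2; apply/idP/idP.
    case/or3P=> [/eqP->||]; [exact: branch_root | exact: branch_sub | exact: branch_sub].
  case/(branch_case vw) => [->|[u [vu uw xu]]]; first by rewrite eqxx.
  have := nbr _ vu; rewrite !inE (negbTE uw) /=.
  by case/orP=> /eqP uE; rewrite uE in xu; apply/or3P; [constructor 2 | constructor 3].
Qed.

End Forest.

Lemma third_range a b : 0 < a <= 3 -> 0 < b <= 3 -> third a b != 0 ->
  [/\ 0 < third a b <= 3, third a b != a, third a b != b & a != b].
Proof.
rewrite /third; case: a => [|[|[|[|a]]]] //; case: b => [|[|[|[|b]]]] //.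
Qed.

Section SingleCycle.
Variables (V : finType) (e T : rel V) (q : seq V).
Hypothesis symE : symmetric e.
Hypothesis cubE : cubic e.
Hypothesis shortE : no_short_cycle e.
Hypothesis symT : symmetric T.
Hypothesis subT : subrel T e.
Hypothesis degT : forall x, (deg T x == 1) || (deg T x == 3).
Hypothesis cycq : cycle (cotree e T) q.
Hypothesis uq : uniq q.
Hypothesis q5 : 5 <= size q.
Hypothesis memq : forall x, (x \in q) = (deg T x == 1).
Notation C := (cotree e T).
Notation c := (size q).

Let symC : symmetric C.
Proof. by move=> x y; rewrite /cotree symE symT. Qed.

Let c0 : 0 < c. Proof. exact: leq_trans q5. Qed.

Lemma index_next x : x \in q -> index (next q x) q = (index x q + 1) %% c.
Proof.
move=> xq; rewrite next_nth xq; case: q uq xq => // y p /= /andP[yp up].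
rewrite inE; case: (altP (y =P x)) => [<-|yx] /=.
  move=> _; case: p yp up => [|z p] /=; first by rewrite eqxx.
  by rewrite inE negb_or => /andP[xz _] _; rewrite ?eqxx (negbTE xz) modn_small.
rewrite eq_sym (negbTE yx) /= => xp.
have := xp; rewrite -index_mem leq_eqVlt => /orP[/eqP E|lt].
  by rewrite E nth_default ?leqnn // eqxx addn1 modnn.
rewrite addn1 modn_small ?ltnS //.
case: (altP (y =P _)) => [E|_]; first by rewrite E mem_nth in yp.
by rewrite index_uniq.
Qed.

Lemma next_cotree x : x \in q -> C x (next q x).
Proof. exact: next_cycle. Qed.

Let index_inj x y : x \in q -> y \in q -> index x q = index y q -> x = y.
Proof. by move=> xq yq E; rewrite -(nth_index x xq) E nth_index. Qed.

Lemma near1_cotree x y : x \in q -> y \in q -> near c 1 (index x q) (index y q) -> C x y.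
Proof.
move=> xq yq /orP[] /eqP; rewrite -index_next // => /index_inj E.
  by rewrite E ?mem_next // next_cotree.
by rewrite symC (E xq) ?mem_next // next_cotree.
Qed.

Lemma near2_cotree x y : x \in q -> y \in q -> near c 2 (index x q) (index y q) ->
  exists2 z, z \in q & C x z && C z y.
Proof.
have fwd u v : u \in q -> v \in q -> index v q = (index u q + 2) %% c ->
    exists2 z, z \in q & C u z && C z v.
  move=> uq' vq E; exists (next q u); rewrite ?mem_next // next_cotree //=.
  have -> : v = next q (next q u); last by rewrite next_cotree // mem_next.
  apply: index_inj; rewrite ?mem_next // E !index_next ?mem_next //.
  by rewrite modnDml -addnA.
move=> xq yq /orP[] /eqP E; first exact: fwd.
have [z zq /andP[yz zx]] := fwd y x yq xq E.
by exists z; rewrite // symC zx symC.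
Qed.

Lemma leaf_unique x y z : deg T x = 1 -> T x y -> T x z -> y = z.
Proof.
move/eqP/cards1P => [u /setP E] xy xz.
by have := E y; have := E z; rewrite !inE xy xz => /esym/eqP-> /esym/eqP->.
Qed.

Lemma internal_tree x y : deg T x = 3 -> e x y -> T x y.
Proof.
move=> d3 xy; have : [set y | T x y] == [set y | e x y].
  rewrite eqEcard -/(deg e x) -/(deg T x) cubE d3 leqnn andbT.
  by apply/subsetP => z; rewrite !inE; apply: subT.
by move/eqP/setP/(_ y); rewrite !inE xy.
Qed.

Lemma leaves_at0 v t i : hanging T v t -> i \in leaves_at 0 (positions q t) ->
  [/\ T (top t) v, top t \in q & i = index (top t) q].
Proof.
case: t => //= x [xv dx]; rewrite inE => /eqP->; split=> //.
by rewrite memq dx.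
Qed.

Lemma hanging_top v t : hanging T v t -> T (top t) v.
Proof. by case: t => [x []|x t1 t2 []]. Qed.

Lemma leaves_at1 v t i : hanging T v t -> i \in leaves_at 1 (positions q t) ->
  exists y, [/\ T y (top t), y \in q, i = index y q & y != v].
Proof.
case: t => //= x t1 t2 [xv dx /=]; rewrite !inE negb_or andbT => /andP[/andP[v1 v2] _] [h1 h2].
rewrite mem_cat => /orP[] /leaves_at0 H.
  by have [] := H _ h1; exists (top t1); split=> //; rewrite eq_sym.
by have [] := H _ h2; exists (top t2); split=> //; rewrite eq_sym.
Qed.

(** A forbidden pair of leaves would close a triangle or a 4-cycle through [v]. *)
Lemma hanging_far v t1 t2 : hanging T v t1 -> hanging T v t2 -> top t1 != top t2 ->
  far c (positions q t1) (positions q t2).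
Proof.
case: shortE => _ tri sq.
have T01 s1 s2 : hanging T v s1 -> hanging T v s2 -> top s1 != top s2 ->
    all (fun i => all (fun j => ~~ near c 1 i j) (leaves_at 1 (positions q s2)))
      (leaves_at 0 (positions q s1)).
  move=> h1 h2 s12; apply/allP => i /(leaves_at0 h1)[xv xq ->].
  apply/allP => j /(leaves_at1 h2)[y [yw yq -> yv]]; apply/negP => /(near1_cotree xq yq)/andP[xy _].
  apply: (sq (top s1) y (top s2) v) => //; first exact: subT.
    by apply: subT; exact: hanging_top h2.
  by apply: subT; rewrite symT.
move=> h1 h2 t12; rewrite /far T01 //=; apply/and3P; split.
- apply/allP => i /(leaves_at0 h1)[xv xq ->].
  apply/allP => j /(leaves_at0 h2)[yv yq ->]; apply/negP => /(near1_cotree xq yq)/andP[xy _].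
  by apply: (tri _ _ v xy); apply: subT; rewrite // symT.
- apply/allP => i /(leaves_at0 h1)[xv xq ->].
  apply/allP => j /(leaves_at0 h2)[yv yq ->]; apply/negP => /(near2_cotree xq yq)[z zq].
  case/andP=> /andP[xz _] /andP[zy _].
  apply: (sq _ _ _ v xz zy) => //; rewrite ?subT // 1?symT //.
  (* The middle vertex of the outer path is not [v], for then [v] would be a leaf with two tree
     neighbours. *)
  apply: contraNneq t12 => zv; apply/eqP.
  by apply: (@leaf_unique v); rewrite 1?symT //; apply/eqP; rewrite -memq -zv.
- have := T01 _ _ h2 h1; rewrite eq_sym t12 => /(_ isT) /allP H.
  apply/allP => i iP; apply/allP => j /H/allP/(_ i iP).
  by rewrite nearC.
Qed.

Lemma hanging_tree_ok v t : hanging T v t -> tree_ok c (positions q t).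
Proof.
elim: t v => //= x t1 IH1 t2 IH2 v [xv dx u [h1 h2]].
rewrite (IH1 x) // (IH2 x) // (hanging_far h1 h2) //.
by move: u; rewrite /= !inE andbT => /andP[].
Qed.

Lemma hanging_leaf_seq v t : hanging T v t ->
  leaf_seq (positions q t) = [seq index x q | x <- nodes t & deg T x == 1].
Proof.
elim: t v => /= [x|x t1 IH1 t2 IH2] v; first by case=> _ ->; rewrite eqxx.
by case=> xv -> /= _ [h1 h2]; rewrite filter_cat map_cat (IH1 x) // (IH2 x).
Qed.

Lemma hanging_nbr v t x y : hanging T v t -> x \in nodes t -> T x y ->
  (y \in nodes t) || (y == v).
Proof.
elim: t v => /= [u|u t1 IH1 t2 IH2] v.
  case=> uv du; rewrite !inE => /eqP-> uy.
  by rewrite (leaf_unique du uy uv) eqxx orbT.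
case=> uv du uni [h1 h2]; rewrite inE mem_cat => /or3P[/eqP->|x1|x2] xy.
- have : y \in [set v; top t1; top t2].
    suff /eqP-> : [set v; top t1; top t2] == [set z | T u z] by rewrite inE.
    rewrite eqEcard -/(deg T u) du; apply/andP; split.
      apply/subsetP => z; rewrite !inE => /orP[/orP[]|] /eqP-> //; rewrite symT; exact: hanging_top.
    move: uni; rewrite /= !inE negb_or andbT => /andP[/andP[n1 n2] n3].
    by rewrite -setUA !cardsU1 cards1 !inE negb_or n1 n2 n3.
  rewrite !inE mem_cat => /orP[/orP[]|] /eqP->; rewrite ?eqxx ?top_nodes ?orbT //.
- by case/orP: (IH1 _ h1 x1 xy) => [y1|/eqP->]; rewrite inE mem_cat ?y1 ?eqxx ?orbT.
- by case/orP: (IH2 _ h2 x2 xy) => [y1|/eqP->]; rewrite inE mem_cat ?y1 ?eqxx ?orbT.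
Qed.

(** As 0 is absorbing, a nonzero colour at the top rules out conflicts at all nodes below, and the
    colourings of the two subtrees can be glued. *)
Lemma hanging_colour h w t : hanging T w t -> uniq (w :: nodes t) ->
  {in leaf_seq (positions q t), forall i, 0 < h i <= 3} ->
  tree_colour h (positions q t) != 0 ->
  exists f : V -> V -> nat,
    [/\ forall x y, f x y = f y x, forall x y, 0 < f x y <= 3,
        f (top t) w = tree_colour h (positions q t),
        forall x y, x \in nodes t -> deg T x = 1 -> T x y -> f x y = h (index x q) &
        forall x y z, x \in nodes t -> deg T x = 3 -> T x y -> T x z -> y != z ->
          f x y != f x z].
Proof.
elim: t w => /= [v|v t1 IH1 t2 IH2] w.
  case=> vw dv _ hP _; exists (fun _ _ => h (index v q)); split=> //.
  - by move=> _ _; apply: hP; rewrite mem_head.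
  - by move=> x y; rewrite inE => /eqP->.
  - by move=> x y z; rewrite inE => /eqP->; rewrite dv.
case=> vw dv uni [h1 h2]; rewrite cat_uniq inE !mem_cat !negb_or.
case/and3P=> /and3P[wv w1 w2] /andP[v1 v2] /and3P[u1 dis u2] hP col0.
have hP1 : {in leaf_seq (positions q t1), forall i, 0 < h i <= 3}.
  by move=> i i1; apply: hP; rewrite mem_cat i1.
have hP2 : {in leaf_seq (positions q t2), forall i, 0 < h i <= 3}.
  by move=> i i2; apply: hP; rewrite mem_cat i2 orbT.
have [c1 c2] : tree_colour h (positions q t1) != 0 /\ tree_colour h (positions q t2) != 0.
  by move: col0; rewrite /third; do 2!case: (tree_colour h _).
have [|f1 [f1C f1r f1t f1l f1i]] := IH1 v h1 _ hP1 c1; first by rewrite /= v1.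
have [|f2 [f2C f2r f2t f2l f2i]] := IH2 v h2 _ hP2 c2; first by rewrite /= v2.
have [cr n1 n2 n12] : [/\ 0 < third (tree_colour h (positions q t1)) (tree_colour h (positions q t2)) <= 3,
  third (tree_colour h (positions q t1)) (tree_colour h (positions q t2)) != tree_colour h (positions q t1),
  third (tree_colour h (positions q t1)) (tree_colour h (positions q t2)) != tree_colour h (positions q t2)
  & tree_colour h (positions q t1) != tree_colour h (positions q t2)].
  by apply: third_range => //; rewrite -?f1t -?f2t.
set cw := third _ _ in cr n1 n2 *.
(* Edges meeting a subtree, including the one that joins it to [v], are coloured there; what is left
   is the edge from [v] to [w]. *)
pose f x y := if (x \in nodes t1) || (y \in nodes t1) then f1 x y
  else if (x \in nodes t2) || (y \in nodes t2) then f2 x y else cw.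
have dis' x : x \in nodes t2 -> x \notin nodes t1 by move/hasPn: dis; apply.
have fe1 x y : x \in nodes t1 -> f x y = f1 x y by rewrite /f => ->.
have fe2 x y : x \in nodes t2 -> T x y -> f x y = f2 x y.
  move=> x2 xy; rewrite /f (negbTE (dis' _ x2)) x2 /=.
  case: ifP => // y1; case/orP: (hanging_nbr h2 x2 xy) => [/dis'|/eqP yv].
    by rewrite y1.
  by rewrite yv (negbTE v1) in y1.
have Tt1 : T v (top t1) by rewrite symT; exact: hanging_top.
have Tt2 : T v (top t2) by rewrite symT; exact: hanging_top.
have fC x y : f x y = f y x.
  by rewrite /f f1C f2C ![(x \in _) || _]orbC.
have fw : f v w = cw by rewrite /f (negbTE v1) (negbTE v2) (negbTE w1) (negbTE w2).
have ft1 : f v (top t1) = tree_colour h (positions q t1).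
  by rewrite fC fe1 ?top_nodes.
have ft2 : f v (top t2) = tree_colour h (positions q t2).
  by rewrite fC fe2 ?top_nodes // symT.
exists f; split=> //.
- by move=> x y; rewrite /f; case: ifP => // _; case: ifP.
- move=> x y; rewrite inE mem_cat => /or3P[/eqP->|x1|x2] dx xy.
  + by rewrite dv in dx.
  + by rewrite fe1 // f1l.
  + by rewrite fe2 // f2l.
- move=> x y z; rewrite inE mem_cat => /or3P[/eqP->|x1|x2] dx xy xz yz.
  + have nbr u : T v u -> [\/ u = w, u = top t1 | u = top t2].
      move=> vu; have : u \in [set w; top t1; top t2].
        suff /eqP-> : [set w; top t1; top t2] == [set z | T v z] by rewrite inE.
        rewrite eqEcard -/(deg T v) dv; apply/andP; split.
          by apply/subsetP => u'; rewrite !inE => /orP[/orP[]|] /eqP-> //.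
        move: uni; rewrite /= !inE negb_or andbT => /andP[/andP[m1 m2] m3].
        by rewrite -setUA !cardsU1 cards1 !inE negb_or m1 m2 m3.
      by rewrite !inE => /orP[/orP[]|] /eqP->; [constructor 1 | constructor 2 | constructor 3].
    have [yE|yE|yE] := nbr y xy; have [zE|zE|zE] := nbr z xz;
      move: yz; rewrite yE zE ?eqxx // => _; rewrite ?fw ?ft1 ?ft2 // eq_sym //.
  + by rewrite !fe1 //; apply: f1i.
  + by rewrite !fe2 //; apply: f2i.
Qed.

Definition cycle_edge_colour (x : seq nat) (u v : V) : nat :=
  let i := index u q in let j := index v q in
  if j == (i + 1) %% c then nth 0 x i else
  if i == (j + 1) %% c then nth 0 x j else 1.

Lemma cycle_edge_colourC x u v : cycle_edge_colour x u v = cycle_edge_colour x v u.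
Proof.
rewrite /cycle_edge_colour; case: eqP => [ji|_]; case: eqP => [ij|_] //.
have ic : index u q < c by rewrite ij ltn_mod.
(* Both tests can succeed only if [c] divides 2. *)
have /eqP : index u q + 2 = index u q + 0 %[mod c].
  by rewrite addn0 [RHS]modn_small // [RHS]ij ji modnDml -addnA.
by rewrite eqn_modDl mod0n modn_small // (leq_trans _ q5).
Qed.

(** Outer edges take their colours from [x], tree edges those propagated from the leaves. The tree
    edge at [l], which has position 0, receives a demand from each end; the last hypothesis makes
    the two agree. *)
Lemma single_cycle_colourable x t l u :
  cycle_colouring c x -> head l q = l -> l \in q -> T u l -> top t = u ->
  hanging T l t -> uniq (l :: nodes t) -> (forall v, v != l -> v \in nodes t) ->
  tree_colour (leaf_colour c x) (positions q t) = leaf_colour c x 0 ->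
  three_edge_colourable e.
Proof.
move=> xP hl lq ul topt ht ut covt colt.
set h := leaf_colour c x in colt *.
have xr i : i < c -> (0 < nth 0 x i <= 3) && (nth 0 x i != nth 0 x ((i + 1) %% c)).
  by move=> ic; have /allP := xP; apply; rewrite mem_iota.
have pred_mod i : i < c -> ((i + c.-1) %% c + 1) %% c = i.
  by move=> ic; rewrite modnDml -addnA addn1 prednK // modnDr modn_small.
have hr i : i < c -> [/\ 0 < h i <= 3, h i != nth 0 x ((i + c.-1) %% c), h i != nth 0 x i &
    nth 0 x ((i + c.-1) %% c) != nth 0 x i].
  move=> ic; have /andP[xi _] := xr i ic.
  have /andP[xj] := xr _ (ltn_pmod (i + c.-1) c0); rewrite pred_mod // => xij.
  have [||//|h1 h2 h3 h4] := @third_range (nth 0 x ((i + c.-1) %% c)) (nth 0 x i); rewrite // /third.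
  rewrite (negbTE xij); case/andP: xi; case/andP: xj.
  by case: (nth 0 x _) xij => [|[|[|[|a]]]] //; case: (nth 0 x i) => [|[|[|[|b]]]].
have hP : {in leaf_seq (positions q t), forall i, 0 < h i <= 3}.
  move=> i; rewrite (hanging_leaf_seq ht) => /mapP[y].
  by rewrite mem_filter -memq => /andP[yq _] ->; case: (hr (index y q)); rewrite ?index_mem.
have col0 : tree_colour h (positions q t) != 0.
  by rewrite colt; case: (hr 0 c0) => /andP[]; case: (h 0).
have [f [fC fr ft fl fi]] := hanging_colour ht ut hP col0.
pose g := cycle_edge_colour x.
pose k u v := if T u v then f u v else g u v.
have il : index l q = 0 by move: lq; rewrite -hl; case: (q) => //= a s _; rewrite eqxx.
have kleaf y z : y \in q -> T y z -> k y z = h (index y q).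
  move=> yq yz; rewrite /k yz; case: (altP (y =P l)) => [yl|yl]; last first.
    by apply: fl => //; [exact: covt | apply/eqP; rewrite -memq].
  move: yz; rewrite yl => lz; rewrite (@leaf_unique l z u) ?il //; last by rewrite symT.
    by rewrite fC -topt ft.
  by apply/eqP; rewrite -memq.
have kcyc y z : y \in q -> C y z ->
    z = next q y /\ k y z = nth 0 x (index y q) \/
    z = prev q y /\ k y z = nth 0 x ((index y q + c.-1) %% c).
  move=> yq yz; have [yze nT] := andP yz.
  have dC : deg C y = 2.
    have -> : deg C y = #|[set w | e y w] :\: [set w | T y w]|.
      by apply: eq_card => w; rewrite !inE andbC.
    rewrite cardsD (setIidPr _); last by apply/subsetP => w; rewrite !inE; exact: subT.
    by move: (cubE y) yq; rewrite memq /deg => -> /eqP->.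
  have q3 : 2 < c by exact: leq_trans q5.
  have kg : k y z = g y z by rewrite /k (negbTE nT).
  case/orP: (cycle_closed_nbr symC cycq uq q3 yq dC yz) => /eqP zE; [left | right].
    by rewrite kg /g /cycle_edge_colour zE index_next // eqxx.
  split=> //; rewrite kg /g cycle_edge_colourC /cycle_edge_colour.
  have zq : z \in q by rewrite zE mem_prev.
  have E : index y q = (index z q + 1) %% c by rewrite -index_next // zE next_prev.
  rewrite {1}E eqxx {1}E modnDml -addnA [1 + _]addnC addn1 prednK //.
  by rewrite modnDr modn_small // index_mem.
have kr y z : e y z -> 0 < k y z <= 3.
  move=> yz; rewrite /k; case: ifP => // nT.
  have yq : y \in q.
    by rewrite memq; case/orP: (degT y) => [//|/eqP/internal_tree/(_ yz)]; rewrite nT.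
  have yzC : C y z by rewrite /cotree yz nT.
  have ic : index y q < c by rewrite index_mem.
  have := kcyc y z yq yzC; rewrite /k nT => -[] [_ ->].
    by case/andP: (xr _ ic).
  by case/andP: (xr _ (ltn_pmod (index y q + c.-1) c0)).
have kne y z w : e y z -> e y w -> z != w -> k y z != k y w.
  move=> yz yw zw; case/orP: (degT y) => [d1|/eqP d3]; last first.
    have yz' := internal_tree d3 yz; have yw' := internal_tree d3 yw.
    rewrite /k yz' yw'; apply: fi => //; apply: covt.
    by apply: contraTneq lq => <-; rewrite memq d3.
  have yq : y \in q by rewrite memq.
  have ic : index y q < c by rewrite index_mem.
  have [_ h1 h2 h3] := hr _ ic.
  case: (boolP (T y z)) => Tz; case: (boolP (T y w)) => Tw.
  - by case/eqP: zw; apply: leaf_unique Tz Tw; apply/eqP.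
  - have Cw : C y w by rewrite /cotree yw Tw.
    by rewrite (kleaf y z) //; case: (kcyc y w yq Cw) => [] [_ ->].
  - have Cz : C y z by rewrite /cotree yz Tz.
    by rewrite (kleaf y w) // eq_sym; case: (kcyc y z yq Cz) => [] [_ ->].
  - have Cw : C y w by rewrite /cotree yw Tw.
    have Cz : C y z by rewrite /cotree yz Tz.
    case: (kcyc y z yq Cz) => [] [zE ->]; case: (kcyc y w yq Cw) => [] [wE ->] //.
    + by rewrite zE wE eqxx in zw.
    + by rewrite eq_sym.
    + by rewrite zE wE eqxx in zw.
exists (fun y z => inord (k y z).-1); split=> [y z|y z w yz yw zw].
  by congr (inord _.-1); rewrite /k symT fC /g cycle_edge_colourC.
have inord_inj a b : 0 < a <= 3 -> 0 < b <= 3 -> inord a.-1 = inord b.-1 :> 'I_3 -> a = b.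
  case: a => // a; case: b => // b a3 b3 /(congr1 val).
  by rewrite /= !inordK // => ->.
apply: contra (kne y z w yz yw zw) => /eqP E; apply/eqP.
by apply: inord_inj E; apply: kr.
Qed.

End SingleCycle.

(** * Outer cycles of a given hist *)

Section Forward.
Variables (V : finType) (e T : rel V).
Hypothesis snarkE : snark e.
Hypothesis histT : hist e T.
Notation C := (cotree e T).

Let symE : symmetric e. Proof. by case: snarkE => -[]. Qed.
Let irrE : irreflexive e. Proof. by case: snarkE => -[_ irr] _ _ _ _ x; apply/negbTE. Qed.
Let cubE : cubic e. Proof. by case: snarkE. Qed.
Let shortE : no_short_cycle e.
Proof. by case: snarkE => sg _ _ g5 _; apply: no_short_girth_ge5. Qed.
Let symT : symmetric T. Proof. by case: histT => -[]. Qed.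
Let subT : subrel T e. Proof. by case: histT => -[]. Qed.
Let irrT : irreflexive T.
Proof. by move=> x; apply/negP => /subT; rewrite irrE. Qed.
Let acycT p : ~ is_cycle T p. Proof. by case: histT => -[_ _ _ acyc] _; apply: acyc. Qed.
Let connT x y : connect T x y. Proof. by case: histT => -[]. Qed.
Let degT x : (deg T x == 1) || (deg T x == 3). Proof. by case: histT. Qed.

Let symC : symmetric C. Proof. by move=> x y; rewrite /cotree symE symT. Qed.
Let irrC : irreflexive C. Proof. by move=> x; rewrite /cotree irrE. Qed.

Let degC x : deg C x = if deg T x == 1 then 2 else 0.
Proof.
have -> : deg C x = #|[set w | e x w] :\: [set w | T x w]|.
  by apply: eq_card => w; rewrite !inE andbC.
rewrite cardsD (setIidPr _); last by apply/subsetP => w; rewrite !inE; exact: subT.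
by case/orP: (degT x) (cubE x); rewrite /deg => /eqP-> ->.
Qed.

Lemma outer_cycleP x : deg T x = 1 ->
  exists q, [/\ cycle C q, uniq q, 5 <= size q & q =i connect C x].
Proof.
move=> dx; have [q [cyc uq q3 qx]] : exists q, [/\ cycle C q, uniq q, 2 < size q & q =i connect C x].
  apply: two_regular_cycle => // y xy; rewrite degC; case: eqP => // /eqP dy.
  suff : deg T y == 1 by rewrite (negbTE dy).
  apply: (connect_invariant (P := fun z => deg T z == 1) xy) => [|a b _ ab]; first by rewrite dx.
  apply: contraT => db; have := degC b; rewrite (negbTE db) => /eqP.
  by rewrite cards_eq0 => /eqP/setP/(_ a); rewrite !inE symC ab.
exists q; split=> //; case: snarkE => _ _ _ g5 _; apply: g5; split=> //.
by apply/andP; split=> //; apply: sub_cycle cyc => a b /andP[].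
Qed.

Lemma oc_ge5 : all (leq 5) (oc e T).
Proof.
apply/allP => _ /mapP[X + ->]; rewrite mem_enum => /imsetP[x]; rewrite inE => /eqP/outer_cycleP.
case=> q [_ uq q5 qx] ->; rewrite cardsE -(eq_card qx); exact: leq_trans q5 (eq_leq (esym (card_uniqP uq))).
Qed.

Lemma single_oc : size (oc e T) = 1 -> head 0 (oc e T) = 6 \/ 10 <= head 0 (oc e T).
Proof.
move=> sz1; have := oc_ge5; rewrite /oc in sz1 *.
have [X outX] : exists X, outer_cycles e T = [set X].
  by apply/cards1P; rewrite cardE; rewrite size_map in sz1; rewrite sz1.
rewrite outX enum_set1 /= andbT => X5.
have [l] : exists l, l \in leaves T.
  have : X \in outer_cycles e T by rewrite outX set11.
  by case/imsetP=> l; exists l.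
rewrite inE => /eqP dl; have [q [cyc uq q5 qx]] := outer_cycleP dl.
have compX x : deg T x == 1 -> [set y | connect C x y] = X.
  move=> dx; apply/eqP; rewrite -in_set1 -outX; apply/imsetP; exists x => //.
  by rewrite inE.
have cardX : #|X| = size q.
  by rewrite -(compX l) ?dl // cardsE -(eq_card qx); exact/card_uniqP.
have memq x : (x \in q) = (deg T x == 1).
  apply/idP/idP => [xq|dx].
    have := next_cycle cyc xq; apply: contraTT => dx; apply/negP => Cx.
    have := degC x; rewrite (negbTE dx) => /eqP; rewrite cards_eq0.
    by move/eqP/setP/(_ (next q x)); rewrite !inE Cx.
  rewrite qx; have : x \in X by rewrite -(compX x dx) inE connect0.
  by rewrite -(compX l) ?dl // inE.
have [l0 [s0 qE]] : exists l0 s, q = l0 :: s.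
  by move: q5; case: (q) => // a s _; exists a, s.
rewrite cardX; set c := size q in q5 cardX *.
case: (boolP (c \in [:: 5; 7; 8; 9])) => [c_small|]; last by rewrite !inE; clear -q5; lia.
case: snarkE => _ _ _ _ []; have chk := allP all_trees_colourable_small _ c_small.
have l0q : l0 \in q by rewrite qE mem_head.
have dl0 : deg T l0 = 1 by apply/eqP; rewrite -memq.
have [u lu] : exists u, T l0 u.
  have : 0 < #|[set y | T l0 y]| by rewrite -/(deg T l0) dl0.
  by rewrite card_gt0 => /set0Pn[u]; rewrite inE; exists u.
have ul : T u l0 by rewrite symT.
have [t [topt ht ut nt]] := exists_hanging symT irrT acycT degT ul.
have nul : u != l0 by apply: contraTneq ul => ->; rewrite irrT.
have l0t : l0 \notin nodes t by rewrite nt branch_notin.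
have cov v : v != l0 -> v \in nodes t.
  move=> vl; rewrite nt.
  suff : (v == l0) || (v \in branch T u l0) by rewrite (negbTE vl).
  apply: (connect_invariant (P := fun v => (v == l0) || (v \in branch T u l0)) (connT l0 v)).
    by rewrite eqxx.
  move=> a b + ab; case: (altP (b =P l0)) => //= bl /orP[/eqP al|au].
    by rewrite al in ab; rewrite (leaf_unique dl0 ab lu) branch_root.
  by apply: branch_step au ab bl.
have il : index l0 q = 0 by rewrite qE /= eqxx.
have c0 : 0 < c by apply: leq_trans q5.
have pt : perm_eq (leaf_seq (positions q t)) (iota 1 c.-1).
  rewrite (hanging_leaf_seq q ht); apply: uniq_perm; rewrite ?iota_uniq //.
    rewrite map_inj_in_uniq ?filter_uniq // => x y; rewrite !mem_filter -!memq.
    by move=> /andP[xq _] /andP[yq _] E; rewrite -(nth_index x xq) E nth_index.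
  move=> i; rewrite mem_iota add1n prednK //; apply/mapP/idP => [[x]|/andP[i0 ic]].
    rewrite mem_filter -memq => /andP[xq xt] ->; rewrite index_mem xq andbT lt0n.
    apply: contraNneq l0t => ix; suff -> : l0 = x by [].
    by rewrite -(nth_index x xq) ix -(nth_index x l0q) il.
  exists (nth l q i); last by rewrite index_uniq.
  rewrite mem_filter -memq mem_nth //=; apply: cov.
  by apply: contraTneq i0 => E; rewrite -(index_uniq l ic uq) E il.
have sizet : size (leaf_seq (positions q t)) = c.-1 by rewrite (perm_size pt) size_iota.
have ok : tree_ok c (positions q t).
  exact: (hanging_tree_ok symE shortE symT subT cyc uq memq ht).
have rok : root_ok c (positions q t).
  (* The leaf [l0] counts as a one-vertex subtree hanging from [u] beside the two others. *)
  have far0 s : hanging T u s -> l0 != top s -> far c (Leaf 0) (positions q s).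
    move=> hs ls; rewrite -il.
    by apply: (hanging_far symE shortE symT subT cyc uq memq (t1 := VLeaf l0) _ hs).
  case: t topt ht sizet {ut nt l0t cov pt ok} => [v|v t1 t2] /=.
    by move=> _ _ s1; move: q5; rewrite -/c; clear -s1; lia.
  move=> -> [_ _ uni [h1 h2]] _.
  move: uni; rewrite !inE negb_or andbT => /andP[/andP[n1 n2] _].
  have := far0 _ h1 n1; have := far0 _ h2 n2.
  rewrite /far /root_ok /= !andbT !all_cat => /and3P[a1 a2 a3] /and3P[b1 b2 b3].
  by rewrite a1 a2 a3 b1 b2 b3.
have [x xP colt] := all_trees_colourableP chk c0 ok rok pt.
apply: (single_cycle_colourable symE cubE symT subT degT cyc uq q5 memq xP _ l0q ul topt ht _ cov colt).
  by rewrite qE.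
by rewrite /= l0t.
Qed.

End Forward.

Theorem theorem3 (S : seq nat) (HS : S != [::]) (Hpos : all (fun c => 0 < c) S) :
  (exists (V : finType) (e T : rel V), snark e /\ hist e T /\ perm_eq (oc e T) S)
  <->
  (all (fun c => 5 <= c) S /\ (size S = 1 -> head 0 S = 6 \/ 10 <= head 0 S)).
Proof.
split=> [[V [e [T [sn [hT pS]]]]]|[S5 S1]]; last first.
  by apply: realizable_snark_hist; apply: realizable_all.
split; first by rewrite -(perm_all _ pS); exact: oc_ge5.
move=> sz; have sz' : size (oc e T) = 1 by rewrite (perm_size pS).
have -> : S = oc e T.
  apply/esym; move: pS; case: S HS Hpos sz => [|c []] //= _ _ _.
  by case: (oc e T) sz' => [|d []] // _ /perm_small_eq->.
exact: single_oc.
Qed.
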